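(* Let $p$ be a prime, $K_0$ a field complete with respect to a discrete valuation whose residue field is perfect of characteristic $p$ (the characteristic of $K_0$ may be $0$ or $p$), and $K_n/K_0$ a totally ramified Galois extension of degree $p^n$ with group $G$. Let $T\geq 1$ be an integer. Suppose that the chain $(H_i)$, the elements $\sigma_i$ and the elements $X_j$ (as described in the context) can be chosen so that Assumptions (A1), (A2) and (A3) (with tolerance $T$) hold, and define $\lambda_t$ and $\Psi_i$ as in the context. Then: (i) the elements $\lambda_t\in K_n$ ($t\in\mathbb{Z}$) satisfy $v_n(\lambda_t)=t$ and $\lambda_{t+p^n}=\pi_0\lambda_t$ for all $t$; (ii) the elements $\Psi_1,\dots,\Psi_n\in K_0[G]$ satisfy $\Psi_i(1)=0$, and for all $1\leq i\leq n$ and $j\in\mathbb{Z}$, $$\Psi_i\lambda_j\equiv\begin{cases}\lambda_{j+p^{n-i}b_i}&\text{if }\mathfrak{a}(j)_{(n-i)}\geq 1,\\ 0&\text{if }\mathfrak{a}(j)_{(n-i)}=0,\end{cases}\qquad\text{modulo }\lambda_{j+p^{n-i}b_i}\mathfrak{P}_n^{T},$$ where $\mathfrak{a}(j)_{(n-i)}$ is the coefficient of $p^{n-i}$ in the base-$p$ expansion of $\mathfrak{a}(j)$.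
   Context: Notation: $v_n$ is the normalized valuation of $K_n$ ($v_n(K_n^\times)=\mathbb{Z}$), $\pi_n$ a prime element of $K_n$, $\mathfrak{O}_n$ its valuation ring with maximal ideal $\mathfrak{P}_n$; $\pi_0$ is a fixed prime element of $K_0$. The ramification groups are $G_t=\{\sigma\in G: v_n(\sigma(\pi_n)-\pi_n)\geq t+1\}$. Choose a chain of subgroups $G=H_0\supset H_1\supset\cdots\supset H_n=\{e\}$ with $H_i$ normal in $H_{i-1}$, $H_{i-1}/H_i\cong C_p$, such that every ramification group $G_t$ equals some $H_i$; choose $\sigma_i\in H_{i-1}\setminus H_i$. Let $K_i$ be the fixed field of $H_i$, $v_i$ the normalized valuation of $K_i$, and $b_i=v_n((\sigma_i-1)\pi_n)-1$ (so $b_1\le\dots\le b_n$ are the lower ramification numbers). Assumption (A1): $p\nmid b_1$. Assumption (A2): there is an integer $0\le b<p^n$ with $b_i\equiv b\bmod p^n$ for all $i$. Choose $X_j\in K_j$ ($1\le j\le n$) with $v_j(X_j)=-b_j$ and $v_j((\sigma_j-1)X_j-1)>0$. For $1\le i<j\le n$ fix a decomposition $(\sigma_i-1)X_j=\mu_{i,j}+\epsilon_{i,j}$ with $\mu_{i,j}\in K_0$, $\epsilon_{i,j}\in K_j$, $v_j(\mu_{i,j})=b_i-b_j<v_j(\epsilon_{i,j})$ (possible under (A2)); put $\mu_{j,j}=1$, $\epsilon_{j,j}=(\sigma_j-1)X_j-1$. Assumption (A3) with tolerance $T$: for all $1\le i\le j\le n$, $v_n(\epsilon_{i,j})-v_n(\mu_{i,j})\geq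 (p-1)\sum_{k=1}^{i-1}p^{n-k-1}b_k+(p^{n-i}-p^{n-j})b_i+T$. Binomials: $\binom{Y}{s}=Y(Y-1)\cdots(Y-s+1)/s!$ for $s\ge0$, and $\binom{Y}{s}=0$ for $s<0$. For $0\le a<p^n$ write $a=\sum_{i=1}^n a_{(n-i)}p^{n-i}$ with $0\le a_{(k)}<p$ and set $\rho_a=\prod_{i=1}^n\binom{X_i}{a_{(n-i)}}\in K_n$. For $t\in\mathbb{Z}$ let $\mathfrak{a}(t)$ be the unique integer with $0\le\mathfrak{a}(t)<p^n$ and $\mathfrak{a}(t)\equiv -tb^{-1}\bmod p^n$, let $f_t=(t-v_n(\rho_{\mathfrak{a}(t)}))/p^n\in\mathbb{Z}$, and $\lambda_t=\pi_0^{f_t}\rho_{\mathfrak{a}(t)}$. Truncated exponentiation: for $\Theta\in K_0[G]$ and $c\in K_0$, $\Theta^{[c]}=\sum_{s=0}^{p-1}\binom{c}{s}(\Theta-1)^s$. Define $\Theta_n=\sigma_n$ and, for $1\le i\le n-1$, $\Theta_i=\sigma_i\,\Theta_n^{[-\mu_{i,n}]}\Theta_{n-1}^{[-\mu_{i,n-1}]}\cdots\Theta_{i+1}^{[-\mu_{i,i+1}]}$, and $\Psi_i=\Theta_i-1\in K_0[G]$, acting on $K_n$ via the Galois action. *)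

(* Defs.v *)
From HB Require Import structures.
From mathcomp Require Import all_boot all_order all_algebra.
From mathcomp Require Import all_fingroup all_solvable all_field.
From mathcomp Require Import ring_quotient constructive_ereal.

Set Implicit Arguments.
Unset Strict Implicit.
Unset Printing Implicit Defensive.

Import Order.TTheory GRing.Theory Num.Theory.

Local Open Scope ring_scope.

(* Normalized discrete valuations take their values in Z together with +oo,   *)
(* inside \bar int; -oo is never a value.                                     *)
Record discrete_valuation (K : fieldType) := DiscreteValuation {
  dval :> K -> \bar int;
  dval0 : dval 0 = +oo%E;
  dval_fin : forall x, x != 0 -> dval x \is a fin_num;
  dvalM : forall x y, dval (x * y) = (dval x + dval y)%E;
  dvalD : forall x y, (Order.min (dval x) (dval y) <= dval (x + y))%E;
  dval_surj : forall m : int, exists2 x, x != 0 & dval x = m%:E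
}.

Section ValuationRing.
Variables (K : fieldType) (v : discrete_valuation K).

Lemma dval1 : v 1 = 0%E.
Proof.
have := dvalM v 1 1; have := dval_fin v (oner_neq0 K); rewrite mulr1.
case: (v 1) => //= r _ [] /eqP; rewrite -subr_eq0 opprD addNKr oppr_eq0.
by move/eqP->.
Qed.

Lemma dvalN x : v (- x) = v x.
Proof.
suff vN1 : v (- 1) = 0%E by rewrite -mulN1r dvalM vN1 add0e.
have := dvalM v (- 1) (- 1).
have := @dval_fin _ v (- 1); rewrite oppr_eq0 oner_eq0 => /(_ isT).
rewrite mulN1r opprK dval1; case: (v (- 1)) => //= r _ [] /esym/eqP.
by rewrite -mulr2n mulrn_eq0 /= => /eqP->.
Qed.

Definition valuation_ring : {pred K} := [pred x | (0 <= v x)%E].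

Fact valuation_ring_subring : subring_closed valuation_ring.
Proof.
split=> [|x y|x y]; rewrite !inE ?dval1 // => vx vy.
  by apply: le_trans (dvalD _ _ _); rewrite dvalN le_min vx.
by rewrite dvalM adde_ge0.
Qed.
HB.instance Definition _ :=
  GRing.isSubringClosed.Build K valuation_ring valuation_ring_subring.

Definition vring := {x : K | x \in valuation_ring}.
HB.instance Definition _ := SubChoice.on vring.
HB.instance Definition _ := [SubChoice_isSubComNzRing of vring by <:].

Definition vmax : {pred vring} := [pred x | (0 < v (val x))%E].

Fact vmax_idealr : idealr_closed vmax.
Proof.
split=> [||a x y]; rewrite !inE ?rmorph0 ?rmorph1 ?dval0 ?dval1 //= => vx vy.
apply: lt_le_trans (dvalD v (val a * val x) (val y)).
rewrite lt_min vy andbT dvalM; have := valP a; rewrite inE; move: vx.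
case: (v (val a)) (v (val x)) => [r||] [s||] //=.
by rewrite !lte_fin lee_fin => s_gt0 r_ge0; rewrite ltr_wpDl.
Qed.
HB.instance Definition _ := isIdealr.Build vring vmax vmax_idealr.

Definition residue_ring := {ideal_quot vmax}.
HB.instance Definition _ := GRing.ComNzRing.on residue_ring.

Definition residue_perfect_pchar (p : nat) :=
  (p \in [pchar residue_ring]) /\
  (forall a : residue_ring, exists c : residue_ring, c ^+ p = a).

Definition valuation_complete :=
  forall u : nat -> K,
    (forall m : int, exists N : nat, forall i j : nat,
       (N <= i)%N -> (N <= j)%N -> (m%:E <= v (u i - u j)%R)%E) ->
    exists l : K, forall m : int, exists N : nat, forall i : nat,
       (N <= i)%N -> (m%:E <= v (u i - l)%R)%E.

(* The T-th power of the maximal ideal of the valuation ring.                 *)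
Definition max_ideal_pow (T : nat) : {pred K} := [pred x | (T%:Z%:E <= v x)%E].

End ValuationRing.

Section GaloisGroupRing.
Variables (F : fieldType) (L : splittingFieldType F).
Local Notation G := (gal_of {:L}).

(* The group ring F[G], with its elements written as coefficient functions.   *)
(* MathComp's group law on gal_of is (s * t)%g a = t (s a), the opposite of   *)
(* the composition law s t := s \o t on the Galois group. The convolution     *)
(* below is the one for composition, so that gr_act is a left action.           *)
Definition gal_ring := {ffun G -> F^o}.
HB.instance Definition _ := GRing.Lmodule.on gal_ring.

Definition gr_of (s : G) : gal_ring := [ffun t => (t == s)%:R].
Definition gr_mul (f g : gal_ring) : gal_ring :=
  [ffun u => \sum_(s : G) f s * g (u * s^-1)%g].

Fact gr_mulA : associative gr_mul.
Proof.
move=> f g h; apply/ffunP=> u; rewrite !ffunE.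
under eq_bigr do rewrite ffunE mulr_sumr.
under [RHS]eq_bigr do rewrite ffunE mulr_suml.
rewrite [RHS]exchange_big /=; apply: eq_bigr => s _.
rewrite [RHS](reindex_inj (mulIg s)) /=; apply: eq_bigr => t _.
by rewrite mulgK invMg !mulgA mulrA.
Qed.

Fact gr_mul1l : left_id (gr_of 1%g) gr_mul.
Proof.
move=> f; apply/ffunP=> u; rewrite ffunE (bigD1 1%g) //= big1 => [|s /negPf s1].
  by rewrite ffunE eqxx mul1r invg1 mulg1 addr0.
by rewrite ffunE s1 mul0r.
Qed.

Fact gr_mul1r : right_id (gr_of 1%g) gr_mul.
Proof.
move=> f; apply/ffunP=> u; rewrite ffunE (bigD1 u) //= big1 => [|s /negPf su].
  by rewrite ffunE mulgV eqxx mulr1 addr0.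
by rewrite ffunE -eq_mulgV1 eq_sym su mulr0.
Qed.

Fact gr_mulDl : left_distributive gr_mul +%R.
Proof.
move=> f g h; apply/ffunP=> u; rewrite !ffunE -big_split /=.
by apply: eq_bigr => s _; rewrite ffunE mulrDl.
Qed.

Fact gr_mulDr : right_distributive gr_mul +%R.
Proof.
move=> f g h; apply/ffunP=> u; rewrite !ffunE -big_split /=.
by apply: eq_bigr => s _; rewrite ffunE mulrDr.
Qed.

Fact gr_one_neq0 : gr_of 1%g != 0.
Proof.
apply/eqP=> /ffunP/(_ 1%g); rewrite !ffunE eqxx => /eqP.
by rewrite oner_eq0.
Qed.

HB.instance Definition _ := GRing.Zmodule_isNzRing.Build gal_ring
  gr_mulA gr_mul1l gr_mul1r gr_mulDl gr_mulDr gr_one_neq0.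

Definition gr_act (f : gal_ring) (x : L) : L := \sum_(s : G) f s *: s x.

Lemma gr_act_of (s : G) x : gr_act (gr_of s) x = s x.
Proof.
rewrite /gr_act (bigD1 s) //= big1 => [|t /negPf ts].
  by rewrite ffunE eqxx scale1r addr0.
by rewrite ffunE ts scale0r.
Qed.

Lemma gr_actM f g x : gr_act (f * g) x = gr_act f (gr_act g x).
Proof.
rewrite /gr_act; under eq_bigr do rewrite ffunE scaler_suml.
rewrite exchange_big /=; apply: eq_bigr => s _.
rewrite linear_sum scaler_sumr (reindex_inj (mulIg s)) /=.
apply: eq_bigr => t _.
by rewrite mulgK linearZ /= scalerA galM ?memvf.
Qed.

End GaloisGroupRing.

(* Y (Y - 1) ... (Y - s + 1) / s!, in any field where s! is invertible.       *)
Definition fbinom (K : fieldType) (Y : K) (s : nat) : K :=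
  (\prod_(k < s) (Y - k%:R)) / (s`!)%:R.

Definition trunc_exp (F : fieldType) (L : splittingFieldType F) (p : nat)
    (Th : gal_ring L) (c : F) : gal_ring L :=
  \sum_(s < p) fbinom c s *: (Th - 1) ^+ s.

(* The coefficient of p ^ k in the base-p expansion of a.                     *)
Definition digit (p a k : nat) : nat := ((a %/ p ^ k) %% p)%N.

Section Extension.
Variables (F : fieldType) (L : splittingFieldType F).
Variables (v0 : discrete_valuation F) (vL : discrete_valuation L).

(* vL extends v0 with ramification index e.                                   *)
Definition has_ram_index (e : nat) :=
  (0 < e)%N /\ forall x : F, vL x%:A = (e%:Z%:E * v0 x)%E.

Definition totally_ramified := has_ram_index (\dim {:L}).

(* w, restricted to the intermediate field E, is the restriction of vL to E   *)
(* rescaled so that its value group is Z; w is irrelevant outside of E.       *)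
Definition normalized_on (E : {vspace L}) (w : L -> \bar int) :=
  (exists2 e : nat, (0 < e)%N &
     forall x, x \in E -> vL x = (e%:Z%:E * w x)%E) /\
  (exists2 x, x \in E & w x = 1%:E).

Definition ramification_group (piL : L) (t : int) : {set gal_of {:L}} :=
  [set s in 'Gal({:L} / 1)%g | ((t + 1)%:E <= vL (s piL - piL)%R)%E].

Definition ram_number (piL : L) (s : gal_of {:L}) : int :=
  fine (vL (s piL - piL)) - 1.

Section Scaffold.
Variables (p n b : nat) (X : nat -> L) (pi0 : F).

Definition rho (a : nat) : L :=
  \prod_(1 <= i < n.+1) fbinom (X i) (digit p a (n - i)).

(* The Bezout coefficient u of u * b + w * p ^ n = gcd (b, p ^ n) is an       *)
(* inverse of b modulo p ^ n when p does not divide b.                        *)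
Definition frak_a (t : int) : nat :=
  `|((- t * (egcdz b (p ^ n)%N).1) %% (p ^ n)%N)%Z|%N.

(* The quotient is exact under the assumptions on the X i.                    *)
Definition lambda (t : int) : L :=
  pi0 ^ ((t - fine (vL (rho (frak_a t)))) %/ (p ^ n)%N)%Z *: rho (frak_a t).

End Scaffold.
End Extension.

Definition lcong (K : fieldType) (v : discrete_valuation K) (l : K) (T : nat)
    (x y : K) :=
  exists2 z, z \in max_ideal_pow v T & x - y = l * z.

(* Main.v *)
(** Write c_k = p^(n-k) b_k, E_i = (p-1) sum_(k<i) p^(n-k-1) b_k, and let w(a) be
    the valuation of rho_a, namely -sum_k a_(n-k) c_k.  The w(a) are distinct
    modulo p^n, so the rho_a form a K_0-basis along which valuations can be
    computed termwise.  By downward induction on i one shows that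
    Psi_i rho_a equals rho_(a - p^(n-i)) (or 0) up to an error of valuation at
    least w(a) + c_i + E_i + T.  Given this for all j > i, Vandermonde's identity
    shows that Theta_j^[-mu_(i,j)] replaces X_j by X_j - mu_(i,j) in the
    binomials; the error is acceptable because the b_k increase, so that
    E_j + p^(n-j) b_i >= E_i + c_i.  Applying sigma_i undoes these shifts up to the
    eps_(i,j), which (A3) bounds, and replaces X_i by X_i + 1, so that Pascal's rule
    produces the main term.

    The Galois group preserves the valuation since a uniformizer of K_n is a root
    of an Eisenstein polynomial.  The ramification index of K_n over K_j is |H_j|:
    it divides |H_j| because the norm of the uniformizer has valuation |H_j|, and
    powers of a uniformizer of K_j are independent over K_0, which bounds it from
    below. *)

Require Import Defs.
From HB Require Import structures.
From mathcomp Require Import all_boot all_order all_algebra.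
From mathcomp Require Import all_fingroup all_solvable all_field.
From mathcomp Require Import ring_quotient constructive_ereal zify ring.

Set Implicit Arguments.
Unset Strict Implicit.
Unset Printing Implicit Defensive.

Import Order.TTheory GRing.Theory Num.Theory.
Local Open Scope ring_scope.

(** * Lower bounds for valuations *)

Section Valuation.
Variables (K : fieldType) (v : discrete_valuation K).

Definition vge (m : int) (x : K) := (m%:E <= v x)%E.

Lemma vge0 m : vge m 0.
Proof. by rewrite /vge dval0 leey. Qed.

Lemma vgeW m m' x : m' <= m -> vge m x -> vge m' x.
Proof. by move=> le_m; apply: le_trans; rewrite lee_fin. Qed.

Lemma vge_eq m x : v x = m%:E -> vge m x.
Proof. by rewrite /vge => ->. Qed.

Lemma vge_eqW m m' x : v x = m'%:E -> m <= m' -> vge m x.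
Proof. by rewrite /vge => -> ?; rewrite lee_fin. Qed.

Lemma vgeN m x : vge m (- x) = vge m x.
Proof. by rewrite /vge dvalN. Qed.

Lemma vgeD m x y : vge m x -> vge m y -> vge m (x + y).
Proof.
by move=> mx my; apply: le_trans (dvalD _ _ _); rewrite le_min; apply/andP.
Qed.

Lemma vgeB m x y : vge m x -> vge m y -> vge m (x - y).
Proof. by move=> mx my; apply: vgeD; rewrite ?vgeN. Qed.

Lemma vgeB_trans y m x z : vge m (x - y) -> vge m (y - z) -> vge m (x - z).
Proof. by move=> xy yz; rewrite -(subrK y x) -addrA; apply: vgeD. Qed.

Lemma vge_sum I (r : seq I) (P : pred I) (f : I -> K) m :
  (forall i, P i -> vge m (f i)) -> vge m (\sum_(i <- r | P i) f i).
Proof. by move=> mf; elim/big_ind: _ => //; [apply: vge0 | apply: vgeD]. Qed.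

Lemma vgeM m m' x y : vge m x -> vge m' y -> vge (m + m') (x * y).
Proof. by rewrite /vge dvalM EFinD => mx my; apply: leeD. Qed.

Lemma vge_prod I (r : seq I) (P : pred I) (m : I -> int) (f : I -> K) :
  (forall i, P i -> vge (m i) (f i)) ->
  vge (\sum_(i <- r | P i) m i) (\prod_(i <- r | P i) f i).
Proof.
move=> mf; elim/big_ind2: _ => //; first by rewrite /vge dval1.
by move=> *; apply: vgeM.
Qed.

Lemma vgeX m x k : vge m x -> vge (m *+ k) (x ^+ k).
Proof.
move=> mx; elim: k => [|k IHk]; first by rewrite /vge dval1.
by rewrite mulrS exprS; apply: vgeM.
Qed.

Lemma vge_all_eq0 x : (forall m, vge m x) -> x = 0.
Proof.
move=> vx; apply/eqP/negPn/negP => /(dval_fin v).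
case E: (v x) => [r||] // _; have := vx (r + 1).
by rewrite /vge E lee_fin -subr_ge0 opprD addNKr.
Qed.

Lemma dval_neq0 x m : v x = m%:E -> x != 0.
Proof. by apply: contra_eq_neq => ->; rewrite dval0. Qed.

Lemma dvalX x m k : v x = m%:E -> v (x ^+ k) = (m *+ k)%:E.
Proof.
move=> vx; elim: k => [|k IHk]; first by rewrite dval1.
by rewrite mulrS exprS dvalM IHk vx.
Qed.

Lemma dvalV x m : v x = m%:E -> v x^-1 = (- m)%:E.
Proof.
move=> vx; have x0 := dval_neq0 vx.
have := dvalM v x x^-1; rewrite divff // dval1 vx.
have := dval_fin v (invr_neq0 x0); case: (v x^-1) => // r _ [] /esym/eqP.
by rewrite addr_eq0 => /eqP->; rewrite opprK.
Qed.

Lemma dval_prod I (r : seq I) (P : pred I) (m : I -> int) (f : I -> K) :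
  (forall i, P i -> v (f i) = (m i)%:E) ->
  v (\prod_(i <- r | P i) f i) = (\sum_(i <- r | P i) m i)%:E.
Proof.
move=> mf; elim/big_ind2: _ => //; first by rewrite dval1.
by move=> x1 x2 y1 y2 v1 v2; rewrite dvalM v1 v2.
Qed.

(** If the sum had valuation above [m], then so would [x], being the difference of the sum and
    [y]. *)
Lemma dvalDl m x y : v x = m%:E -> vge (m + 1) y -> v (x + y) = m%:E.
Proof.
move=> vx vy; apply/eqP; rewrite eq_le; apply/andP; split; last first.
  by apply: vgeD; [apply: vge_eq | apply: vgeW vy; rewrite lerDl].
rewrite leNgt; apply/negP => vxy.
have: vge (m + 1) (x + y).
  move: vxy; rewrite /vge; case: (v (x + y)) => [r||]; last by [].
    by rewrite lte_fin lee_fin lezD1.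
  by rewrite leey.
move=> /vgeB/(_ vy); rewrite addrK /vge vx lee_fin; lia.
Qed.

Lemma vge_natr m : vge 0 m%:R.
Proof. by elim: m => [|m IH]; rewrite ?vge0 // -addn1 natrD vgeD // /vge dval1. Qed.

(** Here [e] is a relative precision: the difference of the two products telescopes, and exchanging
    one factor costs a relative error [e] while the other factors keep their bounds. *)
Lemma vge_prodB I (r : seq I) (P : pred I) (m : I -> int) (e : int)
    (f g : I -> K) :
  (forall i, P i -> [/\ vge (m i) (f i), vge (m i) (g i)
                      & vge (m i + e) (f i - g i)]) ->
  vge (\sum_(i <- r | P i) m i + e)
    (\prod_(i <- r | P i) f i - \prod_(i <- r | P i) g i).
Proof.
move=> mfg; elim: r => [|i r IHr]; first by rewrite !big_nil subrr vge0.
rewrite !big_cons; case: ifP => // Pi; have [fi gi fgi] := mfg i Pi.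
set f' := \prod_(j <- r | P j) f j; set g' := \prod_(j <- r | P j) g j.
have -> : f i * f' - g i * g' = (f i - g i) * f' + g i * (f' - g') by ring.
apply: vgeD; last by rewrite -addrA; apply: vgeM.
rewrite addrAC; apply: vgeM => //; apply: vge_prod => j Pj.
by case: (mfg j Pj).
Qed.

End Valuation.

(** Vanishing of [p] in the residue ring puts [p] in the maximal ideal, and a positive value is at
    least 1 because values are integers. In characteristic [p] the value is [+oo]. *)
Lemma residue_pchar_dval (K : fieldType) (v : discrete_valuation K) p :
  p \in [pchar (residue_ring v)] -> vge v 1 p%:R.
Proof.
case/andP=> _ /eqP p0.
have : (p%:R : vring v) \in @vmax K v.
  rewrite -[p%:R]subr0 Quotient.idealrBE; apply/eqP.
  have -> : \pi_{ideal_quot (@vmax K v)}%qT (p%:R : vring v) =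
      p%:R :> residue_ring v.
    exact: rmorph_nat.
  by rewrite p0 (rmorph0 (\pi_{ideal_quot (@vmax K v)}%qT)).
rewrite inE /vge.
have -> : val (p%:R : vring v) = p%:R by exact: (rmorph_nat (val : vring v -> K)).
case: (v p%:R) => [r||]; rewrite ?leey // lte_fin lee_fin; lia.
Qed.

(** * Truncated binomial coefficients *)

Section TruncatedBinomials.
Variables (K : fieldType) (p : nat).
Hypothesis natr_neq0 : forall m, (0 < m < p)%N -> m%:R != 0 :> K.

Lemma fact_neq0 s : (s < p)%N -> (s`!)%:R != 0 :> K.
Proof.
elim: s => [|s IHs] lt_s; first by rewrite oner_neq0.
by rewrite factS natrM mulf_neq0 ?IHs ?(ltnW lt_s) // natr_neq0 // lt_s.
Qed.

Lemma fbinom0 (Y : K) : fbinom Y 0 = 1.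
Proof. by rewrite /fbinom big_ord0 mul1r invr1. Qed.

Lemma fbinomS (Y : K) s : (s.+1 < p)%N ->
  s.+1%:R * fbinom Y s.+1 = (Y - s%:R) * fbinom Y s.
Proof.
move=> lt_s; have := fact_neq0 lt_s; rewrite /fbinom big_ord_recr factS natrM /=.
rewrite mulf_eq0 negb_or => /andP[s0 f0].
by move: s.+1%:R s0 => r r0; field; rewrite f0.
Qed.

(** Vandermonde's identity, by induction on [s] after multiplication by [s + 1]. On the right,
    [s + 1] splits as [k + (s + 1 - k)] into the parts [F] and [G]; on the left, [X + Y - s] splits
    as [(Y - k) + (X - (s - k))], and [fbinomS] matches the two. *)
Lemma fbinom_addl (X Y : K) s : (s < p)%N ->
  fbinom (X + Y) s = \sum_(k < s.+1) fbinom Y k * fbinom X (s - k).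
Proof.
elim: s => [|s IHs] lt_s; first by rewrite big_ord1 !fbinom0 mulr1.
have s0 : s.+1%:R != 0 :> K by rewrite natr_neq0.
apply: (mulfI s0); rewrite fbinomS // IHs ?(ltnW lt_s) // !mulr_sumr.
pose F k := k%:R * fbinom Y k * fbinom X (s.+1 - k).
pose G k := (s.+1 - k)%:R * fbinom Y k * fbinom X (s.+1 - k).
transitivity (\sum_(k < s.+1) (F k.+1 + G k)).
  apply: eq_bigr => k _; rewrite /F /G subSS fbinomS; last first.
    by apply: leq_ltn_trans lt_s; apply: ltn_ord.
  have le_ks : (k <= s)%N by rewrite -ltnS.
  rewrite subSn // [_.+1%:R * _ * _]mulrAC fbinomS; last first.
    by apply: leq_ltn_trans lt_s; rewrite ltnS leq_subr.
  by rewrite natrB //; ring.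
rewrite big_split /=; transitivity (\sum_(k < s.+2) F k + \sum_(k < s.+2) G k).
  rewrite [in RHS]big_ord_recl [X in _ = _ + X]big_ord_recr /=.
  by rewrite /F /G subnn !mul0r addr0 add0r.
rewrite -big_split; apply: eq_bigr => k _; rewrite /F /G /=.
have le_ks : (k <= s.+1)%N by rewrite -ltnS.
by rewrite natrB //; ring.
Qed.

(** Vandermonde's identity with second argument 1: [fbinom 1 k] contains the factor [1 - 1] as soon
    as [k] is at least 2, so two terms remain. *)
Lemma fbinom_pascal (Y : K) s : (s < p)%N ->
  fbinom (Y + 1) s - fbinom Y s = if (0 < s)%N then fbinom Y s.-1 else 0.
Proof.
case: s => [|s] lt_s; first by rewrite !fbinom0 subrr.
rewrite fbinom_addl // !big_ord_recl /= big1 => [|k _].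
  have -> : fbinom 1 1 = 1 :> K by rewrite /fbinom big_ord1 subr0 divr1.
  by rewrite fbinom0 subn0 subn1 !mul1r addr0 addrAC subrr add0r.
by rewrite {1}/fbinom 2!big_ord_recl /= subrr mul0r mulr0 !mul0r.
Qed.

End TruncatedBinomials.

Section BinomialValuation.
Variables (K : fieldType) (v : discrete_valuation K) (p : nat).
Hypothesis p_pr : prime p.
Hypothesis v_p : vge v 1 p%:R.

(** Bezout gives [u * m = w * p + 1], of valuation 0 since [v p >= 1]. Both [u] and [m] have
    nonnegative valuation, so both valuations are 0. *)
Lemma dval_natr m : (0 < m < p)%N -> v m%:R = 0%E.
Proof.
case/andP=> m_gt0 lt_mp.
have cop : coprime m p by rewrite coprime_sym prime_coprime // gtnNdvd.
case: (egcdnP p m_gt0) => u w Euw _.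
have v1 : v (u * m)%:R = 0%:E.
  rewrite Euw (eqP cop) natrD natrM addrC; apply: dvalDl; first exact: dval1.
  by apply: vgeM; first exact: vge_natr.
have [] := (vge_natr v u, vge_natr v m); move: v1; rewrite natrM dvalM /vge.
case: (v u%:R) (v m%:R) => [r||] [s||] // [E].
by rewrite !lee_fin => r0 s0; congr (_%:E); lia.
Qed.

Lemma dval_natr_neq0 m : (0 < m < p)%N -> m%:R != 0 :> K.
Proof. by move/dval_natr; apply: dval_neq0. Qed.

Lemma dval_factV s : (s < p)%N -> v (s`!)%:R^-1 = 0%E.
Proof.
move=> lt_s; rewrite -[0%E]/((- 0)%:E); apply: dvalV.
elim: s lt_s => [|s IHs] lt_s; first by rewrite dval1.
by rewrite factS natrM dvalM dval_natr ?add0e ?IHs // ltnW.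
Qed.

Lemma vge_fbinom (c : int) Y s : 0 <= c -> vge v (- c) Y -> (s < p)%N ->
  vge v (- (c *+ s)) (fbinom Y s).
Proof.
move=> c0 vY lt_s; rewrite /fbinom -[- _]addr0.
apply: vgeM; last by apply: vge_eq; apply: dval_factV.
have -> : - (c *+ s) = \sum_(k < s) (- c) by rewrite sumr_const card_ord mulNrn.
apply: vge_prod => k _; apply: vgeB => //.
by apply: vgeW (vge_natr v k); rewrite oppr_le0.
Qed.

Lemma dval_fbinom (c : int) Y s : 0 < c -> v Y = (- c)%:E -> (s < p)%N ->
  v (fbinom Y s) = (- (c *+ s))%:E.
Proof.
move=> c0 vY lt_s; rewrite /fbinom dvalM dval_factV // adde0.
have -> : - (c *+ s) = \sum_(k < s) (- c) by rewrite sumr_const card_ord mulNrn.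
apply: dval_prod => k _; apply: dvalDl => //; rewrite vgeN.
by apply: vgeW (vge_natr v k); lia.
Qed.

(** Measured against the bound [- c] for [Y], adding [z] is a relative error [c + e] in every
    factor, hence also in the product. *)
Lemma vge_fbinomB (c e : int) Y z s : 0 <= c -> - c <= e -> vge v (- c) Y ->
  vge v e z -> (s < p)%N ->
  vge v (- (c *+ s) + (c + e)) (fbinom (Y + z) s - fbinom Y s).
Proof.
move=> c0 ce vY vz lt_s; rewrite /fbinom -mulrBl -[_ + (c + e)]addr0.
apply: vgeM; last by apply: vge_eq; apply: dval_factV.
have -> : - (c *+ s) = \sum_(k < s) (- c) by rewrite sumr_const card_ord mulNrn.
apply: vge_prodB => k _.
have vk : vge v (- c) (Y - k%:R).
  apply: vgeB => //; apply: vgeW (vge_natr v k); lia.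
have -> : Y + z - k%:R = Y - k%:R + z by ring.
split=> //; first by apply: vgeD => //; apply: vgeW vz.
by rewrite addrAC subrr add0r addKr.
Qed.

End BinomialValuation.

(** * Totally ramified extensions *)

Section Ramified.
Variables (F : fieldType) (L : splittingFieldType F).
Variables (v0 : discrete_valuation F) (v : discrete_valuation L).
Variable N : nat.
Hypothesis ram : has_ram_index v0 v N.

Lemma ram_gt0 : (0 < N)%N. Proof. by case: ram. Qed.

Lemma dval_scale (c : F) x m k : v0 c = m%:E -> v x = k%:E ->
  v (c *: x) = (N%:Z * m + k)%:E.
Proof. by case: ram => _ vA vc vx; rewrite -mulr_algl dvalM vA vc vx. Qed.

Lemma dval_scaleP (c : F) x k : c != 0 -> v x = k%:E ->
  v (c *: x) = (N%:Z * fine (v0 c) + k)%:E.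
Proof.
move=> /(dval_fin v0) c0 vx; apply: dval_scale => //.
by case: (v0 c) c0.
Qed.

Section Independent.
Variables (I : finType) (r : I -> int) (e : I -> L).
Hypothesis v_e : forall i, v (e i) = (r i)%:E.
Hypothesis r_inj : forall i j, (r i = r j %[mod N])%Z -> i = j.

(* The nonzero terms have distinct valuations modulo N, so a single one of    *)
(* them attains the minimum.                                                  *)
Lemma vge_indep (c : I -> F) m : vge v m (\sum_i c i *: e i) ->
  forall i, vge v m (c i *: e i).
Proof.
move=> vsum i; have [->|ci] := eqVneq (c i) 0; first by rewrite scale0r vge0.
pose val j := N%:Z * fine (v0 (c j)) + r j.
have [k ck k_min] := @arg_minP _ _ I i (fun j => c j != 0) val ci.
suff vk : v (\sum_i c i *: e i) = (val k)%:E.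
  move: vsum; rewrite /vge vk (dval_scaleP ci (v_e i)) !lee_fin => le_mk.
  exact: le_trans le_mk (k_min i ci).
rewrite (bigD1 k) //=; apply: dvalDl; first exact: dval_scaleP.
apply: vge_sum => j jk; have [->|cj] := eqVneq (c j) 0.
  by rewrite scale0r vge0.
apply: vge_eqW (dval_scaleP cj (v_e j)) _; rewrite lezD1 lt_neqAle k_min // andbT.
apply: contra jk => /eqP Ejk; apply/eqP/r_inj.
have := congr1 (fun z => (z %% N)%Z) Ejk.
by rewrite /= /val ![N%:Z * _]mulrC !modzMDl => ->.
Qed.

Lemma indep_eq0 (c : I -> F) : \sum_i c i *: e i = 0 -> forall i, c i = 0.
Proof.
move=> sum0 i; have : c i *: e i = 0.
  by apply: (@vge_all_eq0 _ v) => m; apply: vge_indep; rewrite sum0 vge0.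
by move/eqP; rewrite scaler_eq0 (negPf (dval_neq0 (v_e i))) orbF => /eqP.
Qed.

End Independent.

Section IndependentTuple.
Variables (k : nat) (r : 'I_k -> int) (e : 'I_k -> L).
Hypothesis v_e : forall i, v (e i) = (r i)%:E.
Hypothesis r_inj : forall i j, (r i = r j %[mod N])%Z -> i = j.

Lemma indep_free : free [tuple e i | i < k].
Proof.
apply/freeP => c c0; apply: (indep_eq0 v_e r_inj); rewrite -[RHS]c0.
by apply: eq_bigr => i _; rewrite (nth_map i) ?size_enum_ord // nth_ord_enum.
Qed.

Lemma indep_dim (U : {vspace L}) : (forall i, e i \in U) -> (k <= \dim U)%N.
Proof.
move=> eU; rewrite -{1}(size_tuple [tuple e i | i < k]) -(eqP indep_free).
by apply/dimvS/span_subvP => x /mapP[i _ ->].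
Qed.

Lemma indep_span : k = \dim {:L} ->
  forall x, exists c : 'I_k -> F, x = \sum_i c i *: e i.
Proof.
move=> kL x; set B := [tuple e i | i < k].
have BL : basis_of fullv B by rewrite basisEfree indep_free subvf size_tuple kL /=.
exists (fun i => coord B i x); rewrite {1}(coord_basis BL (memvf x)).
by apply: eq_bigr => i _; rewrite (nth_map i) ?size_enum_ord // nth_ord_enum.
Qed.

(** The valuations of the basis are distinct modulo [N], so a bound on [x] holds for each term of
    its expansion ([vge_indep]), and [f] may be estimated term by term. *)
Lemma vge_linear (f : {linear L -> L}) (m : int) : k = \dim {:L} ->
  (forall i, vge v (r i + m) (f (e i))) ->
  forall l x, vge v l x -> vge v (l + m) (f x).
Proof.
move=> kL vf l x vx; have [c Ex] := indep_span kL x.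
rewrite Ex linear_sum; apply: vge_sum => i _.
have: vge v l (c i *: e i) by apply: (vge_indep v_e r_inj); rewrite -Ex.
rewrite linearZ /=; have [->|ci] := eqVneq (c i) 0.
  by rewrite !scale0r !vge0.
rewrite {1}/vge (dval_scaleP ci (v_e i)) lee_fin => le_l.
rewrite -mulr_algl; have vc : vge v (N%:Z * fine (v0 (c i))) (c i)%:A.
  by apply: vge_eq; rewrite (dval_scaleP ci (dval1 v)) addr0.
by apply: vgeW (vgeM vc (vf i)); rewrite addrA lerD2r.
Qed.

End IndependentTuple.

Section Uniformizer.
Hypothesis dimL : \dim {:L} = N.
Variables (pi : L).
Hypothesis v_pi : v pi = 1%:E.

Lemma dval_unif_X k : v (pi ^+ k) = k%:Z%:E.
Proof. by rewrite (dvalX k v_pi) natz. Qed.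

Lemma ord_mod_inj k (i j : 'I_k) : (k <= N)%N ->
  (i%:Z = j%:Z %[mod N])%Z -> i = j.
Proof.
move=> le_kN; rewrite !modz_small ?lez_nat ?ltz_nat ?(leq_trans (ltn_ord _)) //.
by case=> /ord_inj.
Qed.

(** The relation comes from the minimal polynomial. A degree below [N] would contradict the
    independence of the powers of [pi]; in degree [N], the sum of the lower terms has valuation [N],
    which bounds each of them. *)
Lemma unif_Eisenstein : exists c : 'I_N -> F,
  pi ^+ N = - \sum_(i < N) c i *: pi ^+ i /\
  forall i, vge v N (c i)%:A.
Proof.
have /polyOver1P[q Eq] := minPolyOver 1%AS pi.
set m := adjoin_degree 1%AS pi.
have sq : size q = m.+1 by rewrite -(size_map_poly (in_alg L)) -Eq size_minPoly.
have qm : q`_m = 1.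
  have := monic_minPoly 1%AS pi; rewrite Eq map_monic monicE lead_coefE sq.
  by move/eqP.
have q0 : \sum_(i < m.+1) q`_i *: pi ^+ i = 0.
  have /rootP := root_minPoly 1%AS pi; rewrite Eq horner_coef size_map_poly sq.
  by move=> {2}<-; apply: eq_bigr => i _; rewrite coef_map mulr_algl.
have le_mN : (m <= N)%N.
  have := dim_Fadjoin 1%AS pi; rewrite dimv1 muln1 -/m => <-.
  by rewrite -dimL dimvS ?subvf.
have Em : m = N.
  apply/eqP; rewrite eqn_leq le_mN leqNgt; apply/negP => lt_mN.
  have := @indep_eq0 'I_m.+1 (fun i => i%:Z) (fun i => pi ^+ i)
    (fun i => dval_unif_X i) (fun i j => ord_mod_inj lt_mN) _ q0 ord_max.
  by rewrite qm => /eqP; rewrite oner_eq0.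
rewrite Em in qm q0; exists (fun i => q`_i); move: q0; rewrite big_ord_recr /=.
rewrite qm scale1r addrC => /eqP; rewrite addr_eq0 => /eqP E.
split=> // i; have : vge v N (\sum_(i < N) q`_i *: pi ^+ i).
  by rewrite -vgeN -E; apply/vge_eq/dval_unif_X.
move/(@vge_indep 'I_N (fun i => i%:Z) (fun i => pi ^+ i) (fun i => dval_unif_X i)
   (fun i j => ord_mod_inj (leqnn N)) _)/(_ i).
have [->|qi] := eqVneq (q`_i) 0; first by rewrite !scale0r vge0.
rewrite /vge (dval_scaleP qi (dval_unif_X i)) (dval_scaleP qi (dval1 v)) !lee_fin.
(* Since [i < N], the inequality [N <= N z + i] forces [z >= 1]. *)
have := ltn_ord i; move: (fine _) => z; case: (lerP 1 z) => ?; nia.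
Qed.

Lemma gal_unif (s : gal_of {:L}) : vge v 1 (s pi).
Proof.
have [c [Ec vc]] := unif_Eisenstein.
have spi0 : s pi != 0 by rewrite fmorph_eq0 (dval_neq0 v_pi).
have : s pi ^+ N = - \sum_(i < N) c i *: s pi ^+ i.
  have -> : s pi ^+ N = s (pi ^+ N) by rewrite rmorphXn.
  rewrite Ec linearN linear_sum; congr (- _).
  by apply: eq_bigr => i _; rewrite linearZ rmorphXn.
have := dval_fin v spi0; case E: (v (s pi)) => [t||] // _ Es.
(* If [t <= 0], the left side of the Eisenstein equation of [s pi] has valuation [N t], while each
   term on the right has valuation at least [N + i t >= N + N t]. *)
rewrite /vge E lee_fin leNgt; apply/negP => t_lt1.
suff : vge v (N%:Z + N%:Z * t) (s pi ^+ N).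
  rewrite /vge (dvalX N E) lee_fin; have := ram_gt0; lia.
rewrite Es vgeN; apply: vge_sum => i _; rewrite -mulr_algl.
apply: vgeW (vgeM (vc i) (vgeX i (vge_eq E))); have := ltn_ord i; nia.
Qed.

Lemma gal_vge (s : gal_of {:L}) m x : vge v m x -> vge v m (s x).
Proof.
rewrite -{2}[m]addr0.
apply: (@vge_linear N (fun i => i%:Z) (fun i => pi ^+ i) (fun i => dval_unif_X i)
  (fun i j => ord_mod_inj (leqnn N)) s 0 (esym dimL)) => i.
by rewrite addr0 rmorphXn; apply: vgeW (vgeX i (gal_unif s)); rewrite natz.
Qed.

Lemma gal_unif_inj (s : gal_of {:L}) : s pi = pi -> s = 1%g.
Proof.
move=> spi; apply/eqP/gal_eqP => x _; rewrite gal_id.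
have [c ->] := @indep_span N (fun i => i%:Z) (fun i => pi ^+ i)
  (fun i => dval_unif_X i) (fun i j => ord_mod_inj (leqnn N)) (esym dimL) x.
rewrite linear_sum; apply: eq_bigr => i _.
by rewrite linearZ rmorphXn; congr (_ *: _ ^+ _).
Qed.

(** A valuation of at least 2 would be inherited by [pi] on applying the inverse of [s]. *)
Lemma dval_gal_unif (s : gal_of {:L}) : v (s pi) = 1%:E.
Proof.
apply/eqP; rewrite eq_le; apply/andP; split; last exact: gal_unif.
rewrite leNgt; apply/negP => vs.
have : vge v 2 (s pi).
  by move: vs; rewrite /vge; case: (v (s pi)) => [t||]; rewrite ?leey.
move/(gal_vge s^-1%g); rewrite -galM ?memvf // mulgV gal_id /vge v_pi lee_fin.
by [].
Qed.

Lemma normalized_on_fixedField (H : {group gal_of {:L}}) (w : L -> \bar int) :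
  normalized_on v (fixedField H) w ->
  forall x, x \in fixedField H -> v x = (#|H|%:Z%:E * w x)%E.
Proof.
case=> -[e e_gt0 ve] [x0 x0H w0].
suff -> : #|H| = e by [].
(* An infinite [w x] would make [v x] infinite, so only the finite case survives. *)
have dvd_e x m : x \in fixedField H -> v x = m%:Z%:E -> (e %| m)%N.
  move=> xH; rewrite ve //; case: (w x) => [r||].
  - by case=> Em; rewrite -[(_ %| _)%N]/(e%:Z %| m%:Z)%Z -Em; apply: dvdz_mulr.
  - by rewrite gt0_muley // lte_fin ltz_nat.
  by rewrite gt0_muleNy // lte_fin ltz_nat.
have vx0 : v x0 = e%:Z%:E by rewrite ve // w0 mule1.
have dvd_eN : (e %| N)%N.
  have [c c0 vc] := dval_surj v0 1; apply: (dvd_e c%:A).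
    by apply: rpredZ; apply: rpred1.
  by case: ram => _ ->; rewrite vc mule1.
(* The norm of [pi] down to the fixed field has valuation [#|H|]. *)
have le_eH : (e <= #|H|)%N.
  apply: dvdn_leq; first exact: cardG_gt0.
  apply: (dvd_e (\prod_(h in H) h pi)).
    apply/fixedFieldP; first exact: memvf.
    move=> s sH; rewrite rmorph_prod (reindex_inj (mulIg s^-1)%g) /=.
    apply: eq_big => [h|h _]; first by rewrite groupMr ?groupV.
    by rewrite -galM ?memvf // mulgKV.
  rewrite (@dval_prod _ v _ _ _ (fun=> 1)) => [|h _]; last exact: dval_gal_unif.
  by rewrite sumr_const natz.
apply/eqP; rewrite eqn_leq le_eH andbT.
(* The powers [x0 ^+ i] with [i < N / e] have valuations [e i < N], distinct modulo [N], so the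
   fixed field has dimension at least [N / e]. As [#|H|] times this dimension is [N], it follows
   that [#|H| <= e]. *)
have := @indep_dim (N %/ e) (fun i => (e * i)%N%:Z) (fun i => x0 ^+ i).
move/(_ _ _ (fixedField H))=> dimH.
have le_dim : (N %/ e <= \dim (fixedField H))%N.
  apply: dimH => [i|i j|i]; last by rewrite rpredX.
    by rewrite (dvalX i vx0) PoszM -mulr_natr natz.
  have lt_eN (k : 'I_(N %/ e)) : (e * k < N)%N.
    by rewrite mulnC -[X in (_ < X)%N](divnK dvd_eN) ltn_mul2r e_gt0 ltn_ord.
  rewrite !modz_small ?lez_nat ?ltz_nat ?lt_eN // => -[] /eqP.
  by rewrite eqn_mul2l (gtn_eqF e_gt0) => /eqP/ord_inj.
have EN : N = (#|H| * \dim (fixedField H))%N.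
  by rewrite dim_fixedField -dim_sup_field ?subvf.
rewrite -(leq_pmul2r (_ : 0 < \dim (fixedField H))%N) ?adim_gt0 // -EN.
by rewrite mulnC -leq_divLR.
Qed.

End Uniformizer.
End Ramified.

(** * The action of the group ring *)

Section GroupRingAction.
Variables (F : fieldType) (L : splittingFieldType F).
Implicit Types f g : gal_ring L.

Fact gr_act_linear f : linear (gr_act f).
Proof.
move=> c x y; rewrite /gr_act scaler_sumr -big_split; apply: eq_bigr => s _.
by rewrite linearP /= scalerDr !scalerA mulrC.
Qed.
HB.instance Definition _ f :=
  GRing.isLinear.Build F L L _ (gr_act f) (gr_act_linear f).

Lemma gr_act_addl f g x : gr_act (f + g) x = gr_act f x + gr_act g x.
Proof.
by rewrite /gr_act -big_split; apply: eq_bigr => s _; rewrite ffunE scalerDl.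
Qed.

Lemma gr_act_scalel c f x : gr_act (c *: f) x = c *: gr_act f x.
Proof.
by rewrite /gr_act scaler_sumr; apply: eq_bigr => s _; rewrite ffunE scalerA.
Qed.

Lemma gr_act_suml I (r : seq I) (P : pred I) (f : I -> gal_ring L) x :
  gr_act (\sum_(i <- r | P i) f i) x = \sum_(i <- r | P i) gr_act (f i) x.
Proof.
elim/big_rec2: _ => [|i y1 y2 _ <-]; last exact: gr_act_addl.
by rewrite /gr_act big1 // => s _; rewrite ffunE scale0r.
Qed.

Lemma gr_act1 x : gr_act (1 : gal_ring L) x = x.
Proof. by rewrite gr_act_of gal_id. Qed.

Lemma gr_act_sub1 f x : gr_act (f - 1) x = gr_act f x - x.
Proof. by rewrite gr_act_addl -scaleN1r gr_act_scalel gr_act1 scaleN1r. Qed.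

Lemma gr_act_trunc_exp p f c x : gr_act (trunc_exp p f c) x =
  \sum_(s < p) fbinom c s *: gr_act ((f - 1) ^+ s) x.
Proof.
by rewrite gr_act_suml; apply: eq_bigr => s _; rewrite gr_act_scalel.
Qed.

Lemma gr_act_prod_fix1 k (f : nat -> gal_ring L) :
  (forall i, (i < k)%N -> gr_act (f i) 1 = 1) ->
  gr_act (\prod_(i < k) f i) 1 = 1.
Proof.
elim: k => [|k IHk] f1; first by rewrite big_ord0 gr_act1.
by rewrite big_ord_recr gr_actM f1 // IHk // => i /ltnW; apply: f1.
Qed.

Lemma gr_act_trunc_exp_fix1 p f c : (0 < p)%N ->
  gr_act (f - 1) 1 = 0 -> gr_act (trunc_exp p f c) 1 = 1.
Proof.
case: p => // p _ f1; rewrite gr_act_trunc_exp big_ord_recl big1 => [|s _].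
  by rewrite fbinom0 expr0 gr_act1 scale1r addr0.
by rewrite exprSr gr_actM f1 linear0 scaler0.
Qed.

End GroupRingAction.

Lemma rmorph_fbinom (K K' : fieldType) (f : {rmorphism K -> K'}) Y s :
  f (fbinom Y s) = fbinom (f Y) s.
Proof.
rewrite /fbinom fmorph_div rmorph_nat rmorph_prod; congr (_ / _).
by apply: eq_bigr => k _; rewrite rmorphB rmorph_nat.
Qed.

(** * Products of binomials indexed by digits *)

Definition upd (A : Type) (f : nat -> A) (i : nat) (y : A) : nat -> A :=
  fun k => if k == i then y else f k.

Lemma upd_same (A : Type) (f : nat -> A) i y : upd f i y i = y.
Proof. by rewrite /upd eqxx. Qed.

Section DigitProducts.
Variables (p n : nat) (F : fieldType) (L : splittingFieldType F).
Variables (v : discrete_valuation L).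
Hypotheses (p_pr : prime p) (v_p : vge v 1 p%:R).
Variable c : nat -> int.

Definition digits_lt (d : nat -> nat) := forall k, (d k < p)%N.

Definition binom_prod (Y : nat -> L) (d : nat -> nat) : L :=
  \prod_(1 <= k < n.+1) fbinom (Y k) (d k).

(** The valuation of [binom_prod Y d] when every [Y k] has valuation [- c k] with [c k] positive;
    see [dval_binom_prod]. *)
Definition weight (d : nat -> nat) : int := - \sum_(1 <= k < n.+1) c k *+ d k.

Lemma binom_prodD1 Y d i : (1 <= i <= n)%N ->
  binom_prod Y d = fbinom (Y i) (d i) *
    \prod_(1 <= k < n.+1 | k != i) fbinom (Y k) (d k).
Proof.
by move=> ?; rewrite /binom_prod (bigD1_seq i) ?iota_uniq // mem_index_iota ltnS.
Qed.

Lemma eq_binom_prod Y Y' d d' :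
  (forall k, (1 <= k <= n)%N -> Y k = Y' k /\ d k = d' k) ->
  binom_prod Y d = binom_prod Y' d'.
Proof. by move=> E; apply: eq_big_nat => k /E[-> ->]. Qed.

Lemma weight_upd d i s : (1 <= i <= n)%N -> (s <= d i)%N ->
  weight (upd d i (d i - s)%N) = weight d + c i *+ s.
Proof.
move=> i_n le_s; rewrite /weight.
rewrite (bigD1_seq i) ?iota_uniq ?mem_index_iota ?ltnS //=.
rewrite [in RHS](bigD1_seq i) ?iota_uniq ?mem_index_iota ?ltnS //= upd_same.
under eq_bigr => k /negPf ki do rewrite /upd ki.
by rewrite mulrnBr //; ring.
Qed.

Lemma digits_lt_upd d i m : (m < p)%N -> digits_lt d -> digits_lt (upd d i m).
Proof. by move=> m_p d_p k; rewrite /upd; case: ifP. Qed.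

Lemma vge_binom_prod Y d : digits_lt d ->
  (forall k, (1 <= k <= n)%N -> 0 <= c k /\ vge v (- c k) (Y k)) ->
  vge v (weight d) (binom_prod Y d).
Proof.
move=> d_p vY; rewrite /weight /binom_prod -sumrN.
rewrite big_seq_cond [X in vge _ _ X]big_seq_cond.
apply: vge_prod => k; rewrite mem_index_iota ltnS andbT => /vY[c0 vYk].
exact: (@vge_fbinom _ v p p_pr v_p).
Qed.

Lemma dval_binom_prod Y d : digits_lt d ->
  (forall k, (1 <= k <= n)%N -> 0 < c k /\ v (Y k) = (- c k)%:E) ->
  v (binom_prod Y d) = (weight d)%:E.
Proof.
move=> d_p vY; rewrite /weight /binom_prod -sumrN.
rewrite big_seq_cond [X in _ = X%:E]big_seq_cond.
apply: dval_prod => k; rewrite mem_index_iota ltnS andbT => /vY[c0 vYk].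
exact: (@dval_fbinom _ v p p_pr v_p).
Qed.

Lemma vge_binom_prodB Y z d (e : int) : digits_lt d -> 0 <= e ->
  (forall k, (1 <= k <= n)%N ->
    [/\ 0 <= c k, vge v (- c k) (Y k) & vge v (- c k + e) (z k)]) ->
  vge v (weight d + e)
    (binom_prod (fun k => Y k + z k) d - binom_prod Y d).
Proof.
move=> d_p e0 vYz; rewrite /weight /binom_prod -sumrN.
rewrite big_seq_cond [X in vge _ _ (X - _)]big_seq_cond.
rewrite [X in vge _ _ (_ - X)]big_seq_cond.
apply: vge_prodB => k; rewrite mem_index_iota ltnS andbT => /vYz[c0 vYk vzk].
have ce : - c k <= - c k + e by rewrite lerDl.
split; try apply: (@vge_fbinom _ v p p_pr v_p) => //.
  by apply: vgeD => //; apply: vgeW vzk.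
rewrite -[e](addNKr (c k)); apply: (@vge_fbinomB _ v p p_pr v_p) => //.
Qed.

(** Vandermonde's identity in the factor [i] alone. Writing the range as [s < p] with a side
    condition lets the sum be compared termwise with [trunc_exp]. *)
Lemma binom_prod_shift Y d i (z : F) : (1 <= i <= n)%N -> digits_lt d ->
  binom_prod (upd Y i (Y i + z%:A)) d =
  \sum_(s < p | (s < (d i).+1)%N) fbinom z s *: binom_prod Y (upd d i (d i - s)%N).
Proof.
move=> i_n d_p.
rewrite -(big_ord_widen _
  (fun s => fbinom z s *: binom_prod Y (upd d i (d i - s)%N))) //.
rewrite (binom_prodD1 _ _ i_n) upd_same (@fbinom_addl _ p) //; last first.
  exact: (dval_natr_neq0 p_pr v_p).
rewrite mulr_suml; apply: eq_bigr => s _.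
rewrite (binom_prodD1 _ _ i_n) upd_same -[RHS]mulr_algl [RHS]mulrA.
rewrite -[(fbinom z s)%:A]/(in_alg L _) rmorph_fbinom; congr (_ * _).
by apply: eq_bigr => k /negPf ki; rewrite /upd ki.
Qed.

Lemma binom_prod_pascal Y d i : (1 <= i <= n)%N -> digits_lt d ->
  binom_prod (upd Y i (Y i + 1)) d - binom_prod Y d =
  if (0 < d i)%N then binom_prod Y (upd d i (d i).-1) else 0.
Proof.
move=> i_n d_p; rewrite !(binom_prodD1 _ _ i_n) !upd_same.
rewrite [X in _ * X - _](eq_bigr (fun k => fbinom (Y k) (d k))); last first.
  by move=> k /negPf ki; rewrite /upd ki.
rewrite -mulrBl (@fbinom_pascal _ p) //; last exact: (dval_natr_neq0 p_pr v_p).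
case: ifP => _; last by rewrite mul0r.
by congr (_ * _); apply: eq_bigr => k /negPf ki; rewrite /upd ki.
Qed.

Lemma gal_binom_prod (s : gal_of {:L}) Y d :
  s (binom_prod Y d) = binom_prod (fun k => s (Y k)) d.
Proof.
by rewrite /binom_prod rmorph_prod; apply: eq_bigr => k _; rewrite rmorph_fbinom.
Qed.

End DigitProducts.

(** * The inductive estimate *)

Lemma mulrn_int (x : int) k : x *+ k = x * k%:Z.
Proof. by rewrite -mulr_natr natz. Qed.

Section ScaffoldCore.
Variables (p n : nat) (F : fieldType) (L : splittingFieldType F).
Variables (v : discrete_valuation L).
Hypotheses (p_pr : prime p) (v_p : vge v 1 p%:R).
Variables (X : nat -> L) (bb : nat -> int) (sigma : nat -> gal_of {:L}).
Variables (mu : nat -> nat -> F) (eps : nat -> nat -> L) (T : nat).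
Variable Theta : nat -> gal_ring L.

Local Notation q k := ((p ^ (n - k))%N%:Z).
Local Notation c := (fun k => q k * bb k).
Local Notation R := (binom_prod n).
Local Notation wt := (weight n c).
Local Notation digits := (digits_lt p).

(** The sum E_i occurring in (A3), so that [gain i] is c_i + E_i + T. *)
Definition excess i : int :=
  (p%:Z - 1) * \sum_(1 <= k < i) (p ^ (n - k - 1))%N%:Z * bb k.
Local Notation gain i := (q i * bb i + excess i + T%:Z).

(** Only the first [k] factors of the product defining [Theta i], from index [n] downwards, so that
    an induction can remove them one at a time. *)
Definition exp_prod i k : gal_ring L :=
  \prod_(k' < k) trunc_exp p (Theta (n - k')%N) (- mu i (n - k')%N).

Hypothesis bb_gt0 : forall i, (1 <= i <= n)%N -> 0 < bb i.
Hypothesis bb_mono : forall i j, (1 <= i <= j)%N -> (j <= n)%N -> bb i <= bb j.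
Hypothesis v_X : forall j, (1 <= j <= n)%N -> v (X j) = (- (q j * bb j))%:E.
Hypothesis v_mu : forall i j, (1 <= i < j)%N -> (j <= n)%N ->
  vge v (q j * (bb i - bb j)) (mu i j)%:A.
Hypothesis mu_diag : forall j, (1 <= j <= n)%N -> mu j j = 1.
Hypothesis sigma_X : forall i j, (1 <= i <= j)%N -> (j <= n)%N ->
  sigma i (X j) = X j + (mu i j)%:A + eps i j.
Hypothesis sigma_X_fix : forall i j, (1 <= j < i)%N -> (i <= n)%N ->
  sigma i (X j) = X j.
Hypothesis v_eps : forall i j, (1 <= i <= j)%N -> (j <= n)%N ->
  vge v (- (q j * bb j) + gain i) (eps i j).
Hypothesis sigma_vge : forall i m x, vge v m x -> vge v m (sigma i x).
Hypothesis Theta_def : forall i, (1 <= i <= n)%N ->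
  Theta i = gr_of (sigma i) * exp_prod i (n - i)%N.
(** The form in which the induction uses that the products [R X d] are a basis with distinct
    valuations modulo [p ^ n]. *)
Hypothesis span_vge : forall (f : {linear L -> L}) (m : int),
  (forall d, digits d -> vge v (wt d + m) (f (R X d))) ->
  forall l x, vge v l x -> vge v (l + m) (f x).

Let c_gt0 i : (1 <= i <= n)%N -> 0 < q i * bb i.
Proof. by move=> i_n; rewrite mulr_gt0 ?bb_gt0 // ltz_nat expn_gt0 prime_gt0. Qed.

Let c_ge0 i : (1 <= i <= n)%N -> 0 <= q i * bb i.
Proof. by move/c_gt0/ltW. Qed.

Lemma excess_ge0 i : (i <= n.+1)%N -> 0 <= excess i.
Proof.
clear - p_pr bb_gt0; move=> i_n.
apply: mulr_ge0; first by have := prime_gt0 p_pr; lia.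
rewrite big_seq_cond; apply: sumr_ge0 => k.
rewrite mem_index_iota andbT => /andP[k0 ki].
rewrite mulr_ge0 // ltW // bb_gt0 //; lia.
Qed.

(** With Q = p^(n-j-1), passing from [j] to [j + 1] lowers the first term on the right by (p-1) Q
    b_i and raises the excess by (p-1) Q b_j, which is at least as much. *)
Lemma excess_mono i j : (1 <= i <= j)%N -> (j <= n)%N ->
  q i * bb i + excess i <= q j * bb i + excess j.
Proof.
clear - p_pr bb_mono; case/andP=> i1.
elim: j => [|j IHj]; first by rewrite leqn0 => /eqP->.
rewrite leq_eqVlt => /predU1P[->//|]; rewrite ltnS => le_ij lt_jn.
apply: le_trans (IHj le_ij (ltnW lt_jn)) _.
rewrite /excess big_nat_recr /=; last exact: leq_trans le_ij.
have -> : (n - j = (n - j.+1).+1)%N by rewrite subnSK.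
rewrite subn1 /= expnS; set Q := (p ^ _)%N.
have le_b : bb i <= bb j by apply: bb_mono; rewrite ?i1 // ltnW.
rewrite mulrDr; have := prime_gt0 p_pr; move: (_ * bigop _ _ _) => S.
rewrite PoszM => p_gt0.
have : 0 <= (p%:Z - 1) * Q%:Z * (bb j - bb i).
  by rewrite !mulr_ge0 // ?subr_ge0 //; lia.
nia.
Qed.

(** The coefficient of (Theta_j - 1)^s in the truncated exponential loses at most s (c_j - q_j b_i),
    whereas [s] applications of Theta_j - 1 gain s c_j. The surplus s q_j b_i drives the estimates
    below. *)
Lemma vge_binom_mu i j s : (1 <= i < j)%N -> (j <= n)%N -> (s < p)%N ->
  vge v (- ((q j * (bb j - bb i)) *+ s)) (fbinom (- mu i j) s)%:A.
Proof.
move=> ij j_n s_p; rewrite -[(fbinom _ s)%:A]/(in_alg L _) rmorph_fbinom.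
apply: (@vge_fbinom _ v p p_pr v_p) => //.
  rewrite mulr_ge0 // subr_ge0 bb_mono //; lia.
rewrite rmorphN vgeN -mulrN opprB; exact: v_mu.
Qed.

(** The claim of the downward induction, stated for digit functions instead of integers [a], so that
    subtracting p^(n-i) becomes the update of one digit. *)
Definition near i := forall d, digits d ->
  vge v (wt d + gain i) (gr_act (Theta i - 1) (R X d) -
    (if (0 < d i)%N then R X (upd d i (d i).-1) else 0)).

Let vge_RX d : digits d -> vge v (wt d) (R X d).
Proof.
move=> d_p; apply: (@vge_binom_prod p n _ L v p_pr v_p) => // k k_n.
by split; [apply: c_ge0 | apply/vge_eq/v_X].
Qed.

(** On the basis, the main term gains exactly c_j in weight and the error gains at least that much,
    the excess being nonnegative. *)
Lemma near_vge j : (1 <= j <= n)%N -> near j -> forall l x, vge v l x ->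
  vge v (l + q j * bb j) (gr_act (Theta j - 1) x).
Proof.
move=> j_n near_j; apply: span_vge => d d_p /=.
rewrite -[gr_act _ _](subrK (if (0 < d j)%N then R X (upd d j (d j).-1) else 0)).
apply: vgeD.
  by apply: vgeW (near_j d d_p); have := @excess_ge0 j; lia.
case: ifP => [dj|_]; last exact: vge0.
rewrite -subn1 -[q j * bb j]mulr1n -(weight_upd c j_n dj).
apply: vge_RX; apply: digits_lt_upd => //.
by apply: leq_ltn_trans (d_p j); rewrite leq_subr.
Qed.

Lemma near_vgeX j s : (1 <= j <= n)%N -> near j -> forall l x, vge v l x ->
  vge v (l + (q j * bb j) *+ s) (gr_act ((Theta j - 1) ^+ s) x).
Proof.
move=> j_n near_j l x vx; elim: s => [|s IHs]; first by rewrite gr_act1 addr0.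
by rewrite exprS gr_actM mulrSr addrA; apply: near_vge.
Qed.

(** Induction on [s]: the earlier error gains c_j by [near_vge], and the new error is that of
    [near j] at a digit function whose weight is already s c_j higher. *)
Lemma near_X j s d : (1 <= j <= n)%N -> near j -> digits d ->
  vge v (wt d + (q j * bb j) *+ s + (excess j + T%:Z))
    (gr_act ((Theta j - 1) ^+ s) (R X d) -
     (if (s <= d j)%N then R X (upd d j (d j - s)%N) else 0)).
Proof.
move=> j_n near_j d_p; elim: s => [|s IHs].
  rewrite gr_act1 (_ : R X (upd _ _ _) = R X d) ?subrr ?vge0 //.
  by apply: eq_binom_prod => k _; rewrite /upd subn0; case: eqP => [->|].
rewrite exprS gr_actM mulrSr.
set M := (X in _ - X) in IHs *; set M' := (X in _ - X).
apply: (vgeB_trans (y := gr_act (Theta j - 1) M)).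
  rewrite -linearB /=.
  by apply: vgeW (near_vge j_n near_j IHs); lia.
rewrite /M /M'; case: (leqP s (d j)) => s_d; last first.
  by rewrite linear0 ltnNge ltnW // subrr vge0.
have d'_p : digits (upd d j (d j - s)%N).
  by apply: digits_lt_upd => //; apply: leq_ltn_trans (d_p j); rewrite leq_subr.
have := near_j _ d'_p; rewrite (weight_upd c) // upd_same subn_gt0.
have -> : R X (upd (upd d j (d j - s)%N) j (d j - s).-1) =
          R X (upd d j (d j - s.+1)%N).
  by apply: eq_binom_prod => k _; rewrite /upd subnS; case: eqP.
by apply: vgeW; lia.
Qed.

Lemma near_trunc_exp i j d : (1 <= i < j)%N -> (j <= n)%N -> near j -> digits d ->
  vge v (wt d + gain i) (gr_act (trunc_exp p (Theta j) (- mu i j)) (R X d) -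
    \sum_(s < p | (s < (d j).+1)%N)
      fbinom (- mu i j) s *: R X (upd d j (d j - s)%N)).
Proof.
move=> ij j_n near_j d_p; have j_n' : (1 <= j <= n)%N by lia.
rewrite gr_act_trunc_exp [X in _ - X]big_mkcond -sumrB; apply: vge_sum => s _.
have := near_X s j_n' near_j d_p; rewrite ltnS.
set M := if _ then _ else 0 => vM; set M' := if _ then _ else 0.
have -> : M' = fbinom (- mu i j) s *: M.
  by rewrite /M /M'; case: ifP => // _; rewrite scaler0.
(* The term [s = 0] is exact. For [s >= 1] the error is at least s q_j b_i + E_j + T, and a single
   copy of q_j b_i suffices for [excess_mono]. *)
rewrite -scalerBr; have [s0|s_gt0] := posnP s.
  rewrite /M s0 gr_act1 (_ : R X (upd _ _ _) = R X d) ?subrr ?scaler0 ?vge0 //.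
  by apply: eq_binom_prod => k _; rewrite /upd subn0; case: eqP => [->|].
rewrite -mulr_algl; apply: vgeW (vgeM (vge_binom_mu ij j_n (ltn_ord s)) vM).
have : q i * bb i + excess i <= q j * bb i + excess j.
  by apply: excess_mono => //; lia.
have : 0 <= q j * bb i * (s%:Z - 1).
  by have /bb_gt0/ltW ? : (1 <= i <= n)%N by [lia]; rewrite !mulr_ge0 //; lia.
move: (wt d) (excess i) (excess j) => w e e'.
rewrite !mulrn_int; lia.
Qed.

Lemma trunc_exp_vge i j : (1 <= i < j)%N -> (j <= n)%N -> near j ->
  forall l x, vge v l x ->
  vge v l (gr_act (trunc_exp p (Theta j) (- mu i j)) x).
Proof.
move=> ij j_n near_j l x vx; rewrite gr_act_trunc_exp; apply: vge_sum => s _.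
have j_n' : (1 <= j <= n)%N by lia.
rewrite -mulr_algl.
apply: vgeW (vgeM (vge_binom_mu ij j_n (ltn_ord s)) (near_vgeX s j_n' near_j vx)).
have : 0 <= q j * bb i * s%:Z 
  by have /bb_gt0/ltW ? : (1 <= i <= n)%N by [lia]; rewrite !mulr_ge0.
rewrite !mulrn_int; lia.
Qed.

Lemma exp_prod_vge i k : (1 <= i)%N -> (k <= n - i)%N ->
  (forall j, (i < j <= n)%N -> near j) ->
  forall l x, vge v l x -> vge v l (gr_act (exp_prod i k) x).
Proof.
move=> i1 k_n near_gt; elim: k k_n => [|k IHk] k_n l x vx.
  by rewrite /exp_prod big_ord0 gr_act1.
rewrite /exp_prod big_ord_recr /= gr_actM; apply: IHk; first exact: ltnW.
by apply: trunc_exp_vge vx; [lia | lia | apply: near_gt; lia].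
Qed.

(** The variables to expect after [exp_prod i (n - m)] has acted. *)
Definition shifted i m : nat -> L :=
  fun k => if (m < k)%N then X k + (- mu i k)%:A else X k.

(* Peeling off the rightmost factor first: it sends a product of binomials in *)
(* X to a combination of such products up to the error, so the induction      *)
(* hypothesis applies to the remaining factors.                               *)
Lemma exp_prod_near i k d : (1 <= i)%N -> (k <= n - i)%N ->
  (forall j, (i < j <= n)%N -> near j) -> digits d ->
  vge v (wt d + gain i)
    (gr_act (exp_prod i k) (R X d) - R (shifted i (n - k)%N) d).
Proof.
move=> i1 k_n near_gt; elim: k k_n d => [|k IHk] k_n d d_p.
  rewrite /exp_prod big_ord0 gr_act1.
  rewrite (_ : R (shifted _ _) d = R X d) ?subrr ?vge0 //.
  by apply: eq_binom_prod => j /andP[_ j_n]; rewrite /shifted ltnNge subn0 j_n.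
rewrite /exp_prod big_ord_recr gr_actM -/(exp_prod i k) /=; set j := (n - k)%N.
have ij : (1 <= i < j)%N by rewrite /j; lia.
have j_n : (j <= n)%N by rewrite /j; lia.
have j_n' : (1 <= j <= n)%N by rewrite j_n; lia.
have near_j : near j by apply: near_gt; lia.
have le_k : (k <= n - i)%N by exact: ltnW.
set S := \sum_(s < p | (s < (d j).+1)%N)
      fbinom (- mu i j) s *: R X (upd d j (d j - s)%N).
apply: (vgeB_trans (y := gr_act (exp_prod i k) S)).
  by rewrite -linearB; apply: exp_prod_vge => //; apply: near_trunc_exp.
have -> : R (shifted i (n - k.+1)%N) d =
    R (upd (shifted i j) j (shifted i j j + (- mu i j)%:A)) d.
  apply: eq_binom_prod => m m_n; split=> //; rewrite /shifted /upd ltnn.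
  case: (eqVneq m j) => [->|mj]; first by rewrite (_ : (_ < j)%N) // /j; lia.
  by have -> : (n - k.+1 < m)%N = (j < m)%N by move: mj; rewrite /j; lia.
rewrite (binom_prod_shift p_pr v_p) // linear_sum -sumrB; apply: vge_sum => s.
rewrite ltnS => s_d; rewrite linearZ -scalerBr -mulr_algl.
have d'_p : digits (upd d j (d j - s)%N).
  by apply: digits_lt_upd => //; apply: leq_ltn_trans (d_p j); rewrite leq_subr.
apply: vgeW (vgeM (vge_binom_mu ij j_n (ltn_ord s)) (IHk le_k _ d'_p)).
rewrite (weight_upd c) //.
have : 0 <= q j * bb i * s%:Z 
  by have /bb_gt0/ltW ? : (1 <= i <= n)%N by [lia]; rewrite !mulr_ge0.
move: (wt d) (excess i) => w e; rewrite !mulrn_int; lia.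
Qed.

Lemma near_step i : (1 <= i <= n)%N ->
  (forall j, (i < j <= n)%N -> near j) -> near i.
Proof.
move=> i_n near_gt d d_p; have [i1 i_le] := andP i_n.
have gain_ge0 : 0 <= gain i.
  by rewrite !addr_ge0 ?c_ge0 ?excess_ge0 // leqW.
have := exp_prod_near i1 (leqnn _) near_gt d_p; rewrite subKn // => /(sigma_vge i).
rewrite linearB /= gal_binom_prod => near_R.
rewrite gr_act_sub1 Theta_def // gr_actM gr_act_of.
set A := sigma i _ in near_R *; set B := binom_prod _ _ _ in near_R.
(* Pascal's rule turns the main term into [U - R X d], whose second part cancels against the -1 in
   Theta_i - 1. It remains to compare the image under [Theta i] with [U]. *)
rewrite -(binom_prod_pascal p_pr v_p X i_n d_p) opprB.
set U := R (upd _ _ _) d; rewrite [X in vge _ _ X]addrA subrK.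
apply: (vgeB_trans (y := B)) => //.
(* [sigma i] fixes X_k for k < i, sends X_i to X_i + 1 + eps_(i,i), and sends X_k - mu_(i,k) to X_k
   + eps_(i,k) for k > i. Thus [z] is the whole deviation of [B] from [U]. *)
pose z k := if (k < i)%N then 0 else eps i k.
have -> : B = R (fun k => upd X i (X i + 1) k + z k) d.
  apply: eq_binom_prod => k /andP[k1 k_le]; split=> //; rewrite /shifted /upd /z.
  case: (ltngtP k i) => [ki|ik|->].
  - by rewrite addr0 sigma_X_fix ?k1.
  - rewrite rmorphD /= sigma_X ?i1 ?(ltnW ik) //= linearZ /= rmorph1 scaleNr; ring.
  by rewrite sigma_X ?i1 ?leqnn // mu_diag // scale1r.
apply: (@vge_binom_prodB p n _ L v p_pr v_p) => // k k_n.
have ck := c_ge0 k_n; split=> //.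
- rewrite /upd; case: eqP => [Ek|_]; last exact/vge_eq/v_X.
  apply: vgeD; first by rewrite Ek; apply/vge_eq/v_X.
  by apply: vgeW (vge_eq (dval1 v)); rewrite oppr_le0.
rewrite /z; case: ltnP => [_|ik]; first exact: vge0.
by have [_ k_le] := andP k_n; apply: v_eps; rewrite ?i1.
Qed.

Lemma near_all i : (1 <= i <= n)%N -> near i.
Proof.
have [m] := ubnP (n - i)%N; elim: m i => // m IHm i lt_m i_n.
by apply: near_step => // j j_n; apply: IHm; lia.
Qed.

Lemma Theta_fix1 i : (1 <= i <= n)%N -> gr_act (Theta i - 1) 1 = 0.
Proof.
clear - p_pr Theta_def.
have [m] := ubnP (n - i)%N; elim: m i => // m IHm i lt_m i_n.
rewrite gr_act_sub1 Theta_def // gr_actM gr_act_of.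
rewrite (gr_act_prod_fix1
  (f := fun k => trunc_exp p (Theta (n - k)%N) (- mu i (n - k)%N))).
  by rewrite rmorph1 subrr.
move=> k k_n; apply: gr_act_trunc_exp_fix1; first exact: prime_gt0.
by apply: IHm; lia.
Qed.

End ScaffoldCore.

(** * Digits and the index of a valuation *)

Section Digits.
Variables (p : nat).
Hypothesis p_gt0 : (0 < p)%N.

Lemma digit_lt a k : (digit p a k < p)%N.
Proof. by rewrite ltn_mod. Qed.

Lemma digit_sum n a : (a < p ^ n)%N ->
  a = (\sum_(1 <= k < n.+1) digit p a (n - k) * p ^ (n - k))%N.
Proof.
pose f k := (digit p a k * p ^ k)%N => lt_a.
rewrite big_add1 /= -[a in LHS](modn_small lt_a).
transitivity (\sum_(0 <= k < n) f k)%N; last first.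
  by rewrite big_nat_rev; apply: eq_bigr => k _.
elim: n {lt_a} => [|n IHn]; first by rewrite modn1 big_geq.
rewrite big_nat_recr //= -IHn /f /digit.
have Ea : a = (a %/ p ^ n %/ p * p ^ n.+1 +
    (a %% p ^ n + a %/ p ^ n %% p * p ^ n))%N.
  by rewrite expnS mulnA [(_ %% _ + _)%N]addnC addnA -mulnDl -!divn_eq.
rewrite [in LHS]Ea modnMDl modn_small //.
have lt_r : (a %% p ^ n < p ^ n)%N by rewrite ltn_pmod // expn_gt0 p_gt0.
have lt_d := ltn_pmod (a %/ p ^ n) p_gt0.
rewrite expnS; apply: leq_trans (_ : (a %/ p ^ n %% p).+1 * p ^ n <= _)%N.
  by rewrite mulSn ltn_add2r.
by rewrite leq_mul2r lt_d orbT.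
Qed.

(** There is no borrow: writing [a = x * p ^ m + r], the digit at [m] is the last digit of [x], and
    since it is nonzero, replacing [x] by [x - 1] alters no other digit. *)
Lemma digit_subX a m k : (0 < digit p a m)%N ->
  digit p (a - p ^ m) k = if k == m then (digit p a m).-1 else digit p a k.
Proof.
rewrite /digit; set Q := (p ^ m)%N.
have Q_gt0 : (0 < Q)%N by rewrite expn_gt0 p_gt0.
rewrite (divn_eq a Q); set x := (a %/ Q)%N; set r := (a %% Q)%N.
have lt_r : (r < Q)%N by rewrite ltn_mod.
rewrite divnMDl // (divn_small lt_r) addn0 => x_mod.
have x_gt0 : (0 < x)%N by case: (x) x_mod; rewrite ?mod0n.
have -> : (x * Q + r - Q = x.-1 * Q + r)%N.
  by rewrite -{1}(prednK x_gt0) mulSn -addnA addKn.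
have Ex : x.-1 = ((x %/ p) * p + (x %% p).-1)%N.
  by rewrite {1}(divn_eq x p) -(prednK x_mod) addnS.
have lt_x : ((x %% p).-1 < p)%N.
  by apply: leq_ltn_trans (leq_pred _) _; rewrite ltn_mod.
case: (ltngtP k m) => [km|mk|->].
- rewrite /Q -(subnK (ltnW km)) expnD !mulnA !divnMDl ?expn_gt0 ?p_gt0 //.
  rewrite -(prednK (_ : 0 < m - k)%N) ?subn_gt0 // expnSr !mulnA.
  by rewrite !modnMDl.
- rewrite /Q -(subnKC (ltnW mk)) expnD !divnMA -/Q !divnMDl //.
  rewrite (divn_small lt_r) !addn0 -(prednK (_ : 0 < k - m)%N) ?subn_gt0 //.
  by rewrite expnS !divnMA {1}Ex divnMDl // (divn_small lt_x) addn0.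
by rewrite -/Q divnMDl // (divn_small lt_r) addn0 Ex modnMDl modn_small.
Qed.

Lemma leq_digit a m : (0 < digit p a m)%N -> (p ^ m <= a)%N.
Proof.
by apply: contraTT; rewrite -ltnNge => lt_a; rewrite /digit divn_small ?mod0n.
Qed.

End Digits.

Lemma frak_a_lt p n b t : (0 < p)%N -> (frak_a p n b t < p ^ n)%N.
Proof.
move=> p_gt0; rewrite /frak_a -ltz_nat gez0_abs.
  by rewrite ltz_pmod // ltz_nat expn_gt0 p_gt0.
by rewrite modz_ge0 // eqz_nat -lt0n expn_gt0 p_gt0.
Qed.

(** Since [frak_a] is [- t] times a Bezout inverse of [b], [t + x b] is congruent to
    [(x - frak_a) b] modulo [p ^ n]. Coprimality cancels [b], and both residues lie below
    [p ^ n]. *)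
Lemma frak_aP p n b t x : (0 < p)%N -> coprime b (p ^ n) -> (x < p ^ n)%N ->
  (x == frak_a p n b t) = ((p ^ n)%N %| t + x%:Z * b%:Z)%Z.
Proof.
move=> p_gt0 cop lt_x; set N := (p ^ n)%N in cop lt_x *.
have N_gt0 : (0 < N)%N by rewrite expn_gt0 p_gt0.
have [u Eu] : exists w, (egcdz b N).1 * b%:Z + w * N%:Z = 1.
  case: egcdzP => u w Euw _; exists w; rewrite Euw.
  by rewrite /gcdz /= (eqP cop).
have [z Ea] : exists z, (frak_a p n b t)%:Z = - t * (egcdz b N).1 - z * N%:Z.
  exists ((- t * (egcdz b N).1) %/ N)%Z.
  rewrite /frak_a gez0_abs ?modz_ge0 // ?eqz_nat -?lt0n // -/N.
have -> : (N %| t + x%:Z * b%:Z)%Z = (N %| (x%:Z - (frak_a p n b t)%:Z) * b%:Z)%Z.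
  have -> : t + x%:Z * b%:Z = (x%:Z - (frak_a p n b t)%:Z) * b%:Z
      + (t * u - z * b%:Z) * N%:Z.
    by rewrite Ea -{1}[t]mulr1 -Eu; ring.
  by rewrite rpredDr // dvdz_mull.
rewrite Gauss_dvdzl; last by rewrite coprimezE coprime_sym.
rewrite -eqz_mod_dvd !modz_small //= ltz_nat //.
exact: frak_a_lt.
Qed.

Lemma dval_exprz (K : fieldType) (v : discrete_valuation K) x m (k : int) :
  v x = m%:E -> v (x ^ k) = (m * k)%:E.
Proof.
case: k => k vx.
  by rewrite -[x ^ _]/(x ^+ k) (dvalX k vx) mulrn_int.
rewrite -[x ^ _]/((x ^+ k.+1)^-1) (dvalV (dvalX k.+1 vx)) mulrn_int.
by rewrite NegzE mulrN.
Qed.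

Lemma vge_alg (F : fieldType) (L : splittingFieldType F)
    (v0 : discrete_valuation F) (v : discrete_valuation L) N m (x : F) :
  has_ram_index v0 v N -> vge v0 m x -> vge v (N%:Z * m) x%:A.
Proof.
case=> N_gt0 vA; rewrite /vge vA; case: (v0 x) => [r||] //.
  by rewrite !lee_fin => /ler_wpM2l->.
by rewrite gt0_muley ?leey // lte_fin ltz_nat.
Qed.

(** All [bb k] are congruent to [b], so the weight is congruent to [- b] times the base-[p]
    expansion of [a]. *)
Lemma weight_mod p n (bb : nat -> int) (b a : nat) : (0 < p)%N ->
  (forall i, (1 <= i <= n)%N -> (bb i = b %[mod (p ^ n)%N])%Z) ->
  (a < p ^ n)%N ->
  ((p ^ n)%N %| weight n (fun k => (p ^ (n - k))%N%:Z * bb k)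
                  (fun k => digit p a (n - k)) + a%:Z * b%:Z)%Z.
Proof.
move=> p_gt0 bb_b lt_a; rewrite {2}(digit_sum p_gt0 lt_a) /weight.
rewrite (big_morph Posz PoszD (erefl 0%:Z)) mulr_suml addrC -sumrB.
rewrite big_seq_cond; apply: rpred_sum => k; rewrite andbT mem_index_iota ltnS.
move=> /bb_b/eqP; rewrite eqz_mod_dvd => dvd_k.
rewrite mulrn_int PoszM.
set d := (digit _ _ _)%:Z; set q := (_ ^ _)%N%:Z.
have -> : d * q * b%:Z - q * bb k * d = - (d * q) * (bb k - b%:Z) by ring.
exact: dvdz_mull.
Qed.

(** * Chains of subgroups *)

Lemma chain_card (gT : finGroupType) p n (H : nat -> {group gT}) : (0 < p)%N ->
  H n :=: 1%g ->
  (forall i, (1 <= i <= n)%N -> (H i <| H i.-1)%g) ->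
  (forall i, (1 <= i <= n)%N -> (H i.-1 / H i \isog Zp p)%g) ->
  forall i, (i <= n)%N -> #|H i| = (p ^ (n - i))%N.
Proof.
move=> p_gt0 Hn nH quoH i i_n; rewrite -{1}(subKn i_n).
have := leq_subr i n.
elim: (n - i)%N => [|k IHk] k_n; first by rewrite subn0 Hn cards1.
have k_n' : (1 <= n - k <= n)%N by rewrite subn_gt0 k_n leq_subr.
have [sH nHH] := andP (nH _ k_n'); have := card_isog (quoH _ k_n').
rewrite card_quotient // card_Zp // => index_p.
by rewrite subnS -(Lagrange sH) index_p IHk ?(ltnW k_n) // expnSr.
Qed.

Lemma chain_sub (gT : finGroupType) n (H : nat -> {group gT}) :
  (forall i, (1 <= i <= n)%N -> (H i <| H i.-1)%g) ->
  forall i j, (i <= j <= n)%N -> H j \subset H i.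
Proof.
move=> nH i j /andP[]; elim: j => [|j IHj]; first by rewrite leqn0 => /eqP->.
rewrite leq_eqVlt => /predU1P[-> //|]; rewrite ltnS => ij jn.
apply: subset_trans (IHj ij (ltnW jn)); exact: normal_sub (nH j.+1 _).
Qed.

(** * Construction of the scaffold *)

Theorem theorem2p6
  (p n : nat) (p_pr : prime p)
  (K0 : fieldType) (v0 : discrete_valuation K0)
  (K0_complete : valuation_complete v0)
  (K0_residue : residue_perfect_pchar v0 p)
  (Kn : splittingFieldType K0) (vn : discrete_valuation Kn)
  (Kn_galois : galois 1 {:Kn})
  (Kn_degree : \dim {:Kn} = (p ^ n)%N)
  (Kn_ram : totally_ramified v0 vn)
  (pi0 : K0) (v_pi0 : v0 pi0 = 1%:E)
  (pin : Kn) (v_pin : vn pin = 1%:E)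
  (T : nat) (T_ge1 : (1 <= T)%N)
  (H : nat -> {group gal_of {:Kn}})
  (H_0 : H 0%N :=: 'Gal({:Kn} / 1)%g)
  (H_n : H n :=: 1%g)
  (H_normal : forall i, (1 <= i <= n)%N -> (H i <| H i.-1)%g)
  (H_quo : forall i, (1 <= i <= n)%N -> (H i.-1 / H i \isog Zp p)%g)
  (H_ram : forall t : int, exists2 i : nat, (i <= n)%N &
     ramification_group vn pin t = H i)
  (sigma : nat -> gal_of {:Kn})
  (sigma_H : forall i, (1 <= i <= n)%N -> sigma i \in (H i.-1 :\: H i)%g)
  (v : nat -> Kn -> \bar int)
  (v_norm : forall i, (i <= n)%N -> normalized_on vn (fixedField (H i)) (v i))
  (X : nat -> Kn) (mu : nat -> nat -> K0) (eps : nat -> nat -> Kn) (b : nat) :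
  let bb (i : nat) : int := ram_number vn pin (sigma i) in
  let a := frak_a p n b in
  let lam := lambda vn p n b X pi0 in
  (* (A1) *)
  ~~ (p %| bb 1%N)%Z ->
  (* (A2) *)
  (b < p ^ n)%N ->
  (forall i, (1 <= i <= n)%N -> (bb i = b %[mod (p ^ n)%N])%Z) ->
  (forall j, (1 <= j <= n)%N ->
     [/\ X j \in fixedField (H j),
         v j (X j) = (- bb j)%:E
       & (0 < v j (sigma j (X j) - X j - 1)%R)%E]) ->
  (forall i j, (1 <= i < j)%N -> (j <= n)%N ->
     [/\ sigma i (X j) - X j = (mu i j)%:A + eps i j,
         eps i j \in fixedField (H j),
         v j (mu i j)%:A = (bb i - bb j)%:E
       & ((bb i - bb j)%:E < v j (eps i j))%E]) ->
  (forall j, (1 <= j <= n)%N ->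
     mu j j = 1 /\ eps j j = sigma j (X j) - X j - 1) ->
  (* (A3) *)
  (forall i j, (1 <= i <= j)%N -> (j <= n)%N ->
     (((p%:Z - 1) * (\sum_(1 <= k < i) (p ^ (n - k - 1))%N%:Z * bb k)
        + ((p ^ (n - i))%N%:Z - (p ^ (n - j))%N%:Z) * bb i + T%:Z)%:E
      <= vn (eps i j) - vn (mu i j)%:A)%E) ->
  forall Theta : nat -> gal_ring Kn,
  Theta n = gr_of (sigma n) ->
  (forall i, (1 <= i < n)%N ->
     Theta i = gr_of (sigma i) *
       \prod_(k < n - i) trunc_exp p (Theta (n - k)%N) (- mu i (n - k)%N)) ->
  let Psi (i : nat) : gal_ring Kn := Theta i - 1 in
  [/\ forall t : int, vn (lam t) = t%:E,
      forall t : int, lam (t + (p ^ n)%N%:Z) = pi0 *: lam t,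
      forall i, (1 <= i <= n)%N -> gr_act (Psi i) 1 = 0
    & forall (i : nat) (j : int), (1 <= i <= n)%N ->
        let l := lam (j + (p ^ (n - i))%N%:Z * bb i) in
        lcong vn l T (gr_act (Psi i) (lam j))
          (if (1 <= digit p (a j) (n - i))%N then l else 0)].
Proof.
move=> bb a lam A1 b_lt A2 hX hmu hdiag A3 Theta Theta_n Theta_i Psi.
have p_gt0 := prime_gt0 p_pr; set N := (p ^ n)%N in A2 b_lt Kn_degree *.
have ram : has_ram_index v0 vn N by rewrite -Kn_degree.
have N_gt0 : (0 < N)%N by rewrite expn_gt0 p_gt0.
have v_p : vge vn 1 p%:R.
  have := vge_alg ram (residue_pchar_dval K0_residue.1).
  by rewrite mulr1 -[_%:A]/(in_alg Kn _) rmorph_nat; apply: vgeW; lia.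
(* For [n > 0], a factor [p] of [b] would divide b_1 by (A2), against (A1). *)
have cop : coprime b N.
  case: (posnP n) => [n0|n_gt0]; first by rewrite /N n0 coprimen1.
  rewrite coprime_sym coprimeXl // prime_coprime //; apply: contra A1 => p_b.
  have /eqP : (bb 1%N = b %[mod N])%Z by apply: A2; rewrite n_gt0.
  rewrite eqz_mod_dvd => dvd_N; rewrite -(subrK b%:Z (bb 1%N)) rpredD //.
  by apply: dvdz_trans dvd_N; rewrite dvdzE /= /N dvdn_exp.
have sub_H := chain_sub H_normal.
have vnE j x : (j <= n)%N -> x \in fixedField (H j) ->
    vn x = ((p ^ (n - j))%N%:Z%:E * v j x)%E.
  move=> j_n xH.
  rewrite (normalized_on_fixedField ram Kn_degree v_pin (v_norm j j_n) xH).
  by rewrite (chain_card p_gt0 H_n H_normal H_quo).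
have vbb i : (1 <= i <= n)%N -> vn (sigma i pin - pin) = (bb i + 1)%:E.
  move=> i_n; have /setDP[_ sH] := sigma_H i i_n.
  have : sigma i pin - pin != 0.
    rewrite subr_eq0; apply: contra sH => /eqP.
    by move/(gal_unif_inj ram Kn_degree v_pin)->; apply: group1.
  move/(dval_fin vn); rewrite /bb /ram_number; case: (vn _) => // r _.
  by rewrite /= subrK.
(* Nonnegativity holds because [sigma i] maps [pin] to an element of the maximal ideal. The value 0
   would make [N] divide [b], impossible for [N > 1] coprime to [b]. *)
have bb_gt0 i : (1 <= i <= n)%N -> 0 < bb i.
  move=> i_n; have : vge vn 1 (sigma i pin - pin).
    by apply: vgeB; [apply: (gal_unif ram Kn_degree v_pin) | apply: vge_eq].
  rewrite /vge vbb // lee_fin lerDr le_eqVlt => /predU1P[bb0|//].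
  have /eqP := A2 i i_n; rewrite -bb0 eqz_mod_dvd sub0r rpredN dvdzE /=.
  case: (posnP n) => [n0|n_gt0]; first by move: i_n; rewrite n0; lia.
  move=> dvd_b.
  move: cop; rewrite /coprime (gcdn_idPr dvd_b) => /eqP N1.
  by have := ltn_expl n (prime_gt1 p_pr); rewrite -/N N1; lia.
have bb_mono i j : (1 <= i <= j)%N -> (j <= n)%N -> bb i <= bb j.
  move=> ij j_n; have i_n : (1 <= i <= n)%N by lia.
  have j_n' : (1 <= j <= n)%N by lia.
  (* The ramification group of index b_i is some H_k. It contains [sigma i], which lies outside H_i,
     so k < i and H_k also contains [sigma j]. *)
  have [k k_n Gk] := H_ram (bb i).
  have /setDP[si nsi] := sigma_H i i_n; have /setDP[sj _] := sigma_H j j_n'.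
  have sik : sigma i \in H k.
    rewrite -Gk inE vbb // lexx andbT -H_0; apply: (subsetP (sub_H _ _ _)) si; lia.
  have ki : (k <= i.-1)%N.
    rewrite leqNgt; apply: contra nsi => ik.
    by apply: (subsetP (sub_H _ _ _)) sik; lia.
  have : sigma j \in H k by apply: (subsetP (sub_H _ _ _)) sj; lia.
  by rewrite -Gk inE vbb // lee_fin lerD2r => /andP[].
have v_X j : (1 <= j <= n)%N -> vn (X j) = (- ((p ^ (n - j))%N%:Z * bb j))%:E.
  move=> j_n; have [XH vX _] := hX j j_n; rewrite (vnE j) ?vX //; last by lia.
  by rewrite -mulrN.
have v_mu i j : (1 <= i <= j)%N -> (j <= n)%N ->
    vn (mu i j)%:A = ((p ^ (n - j))%N%:Z * (bb i - bb j))%:E.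
  move=> ij j_n; case: (eqVneq i j) => [->|ne_ij].
    by have [|-> _] := hdiag j; [lia | rewrite scale1r dval1 subrr mulr0].
  have [|_ _ vmu _] := hmu i j _ j_n; first by lia.
  by rewrite (vnE j) ?vmu // rpredZ ?rpred1.
have sigma_X i j : (1 <= i <= j)%N -> (j <= n)%N ->
    sigma i (X j) = X j + (mu i j)%:A + eps i j.
  move=> ij j_n; case: (eqVneq i j) => [->|ne_ij].
    have [|-> ->] := hdiag j; first by lia.
    by rewrite scale1r; ring.
  have [|E _ _ _] := hmu i j _ j_n; first by lia.
  by rewrite -addrA -E addrC subrK.
have sigma_X_fix i j : (1 <= j < i)%N -> (i <= n)%N -> sigma i (X j) = X j.
  move=> ji i_n; have [|/mem_fixedFieldP[_ fixX] _ _] := hX j; first by lia.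
  have [|si _] := setDP (sigma_H i _); first by lia.
  by apply: fixX; apply: (subsetP (sub_H _ _ _)) si; lia.
have v_eps i j : (1 <= i <= j)%N -> (j <= n)%N ->
    vge vn (- ((p ^ (n - j))%N%:Z * bb j) + ((p ^ (n - i))%N%:Z * bb i +
      excess p n bb i + T%:Z)) (eps i j).
  (* The valuation of mu_(i,j) is q_j (b_i - b_j) with q_j = p^(n-j); its part q_j b_i cancels
     against the one subtracted in (A3). *)
  move=> ij j_n; have := A3 i j ij j_n; rewrite v_mu // -/(excess p n bb i).
  rewrite /vge; case: (vn _) => [r||]; rewrite ?leey // /= !lee_fin; lia.
have Theta_def i : (1 <= i <= n)%N ->
    Theta i = gr_of (sigma i) * exp_prod p n mu Theta i (n - i)%N.
  move=> i_n; case: (eqVneq i n) => [->|ne_in].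
    by rewrite Theta_n subnn /exp_prod big_ord0 mulr1.
  by apply: Theta_i; lia.
pose c k := (p ^ (n - k))%N%:Z * bb k.
pose dig (x : nat) k := digit p x (n - k).
have dig_lt x : digits_lt p (dig x) by move=> k; apply: digit_lt.
have c_gt0 k : (1 <= k <= n)%N -> 0 < c k.
  by move=> k_n; rewrite mulr_gt0 ?bb_gt0 // ltz_nat expn_gt0 p_gt0.
have v_rho x : vn (rho p n X x) = (weight n c (dig x))%:E.
  apply: (dval_binom_prod p_pr v_p (dig_lt x)) => k k_n.
  by split; [apply: c_gt0 | apply: v_X].
have wt_mod x : (x < N)%N -> (N %| weight n c (dig x) + x%:Z * b%:Z)%Z.
  exact: weight_mod.
have span_vge (f : {linear Kn -> Kn}) (m : int) :
    (forall d, digits_lt p d ->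
       vge vn (weight n c d + m) (f (binom_prod n X d))) ->
    forall l x, vge vn l x -> vge vn (l + m) (f x).
  move=> vf; apply: (@vge_linear _ _ _ _ N ram N
    (fun i => weight n c (dig i)) (fun i => rho p n X i)) => // [i j|i].
    (* The weights of [i] and [j] are congruent to [- i b] and [- j b], so congruent weights force
       [i = j] after [b] is cancelled. *)
    move/eqP; rewrite eqz_mod_dvd => dvd_w.
    have : (N %| (i%:Z - j%:Z) * b%:Z)%Z.
      have -> : (i%:Z - j%:Z) * b%:Z = (weight n c (dig i) + i%:Z * b%:Z)
         - (weight n c (dig j) + j%:Z * b%:Z)
         - (weight n c (dig i) - weight n c (dig j)) by ring.
      by apply: rpredB => //; apply: rpredB; apply: wt_mod.
    rewrite Gauss_dvdzl; last by rewrite coprimezE coprime_sym.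
    by rewrite -eqz_mod_dvd => /eqP; apply: ord_mod_inj.
  exact: vf.
have sigma_vge i m x : vge vn m x -> vge vn m (sigma i x).
  exact: (gal_vge ram Kn_degree v_pin).
have mu_diag j : (1 <= j <= n)%N -> mu j j = 1 by move/hdiag=> [].
have v_mu' i j : (1 <= i < j)%N -> (j <= n)%N ->
    vge vn ((p ^ (n - j))%N%:Z * (bb i - bb j)) (mu i j)%:A.
  by move=> ij j_n; apply/vge_eq/v_mu => //; lia.
have near_i := near_all p_pr v_p bb_gt0 bb_mono v_X v_mu' mu_diag sigma_X
  sigma_X_fix v_eps sigma_vge Theta_def span_vge.
have pi0_neq0 := dval_neq0 v_pi0.
have a_lt t : (a t < N)%N by apply: frak_a_lt.
have a_dvd t : (N %| t + (a t)%:Z * b%:Z)%Z.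
  by rewrite -frak_aP // /a -/N a_lt.
(* Both [t] and the weight are congruent to [- a t * b] modulo [N], so the quotient defining the
   exponent of [pi0] is exact. *)
have lam_exp t : ((t - weight n c (dig (a t))) %/ N)%Z * N%:Z
    = t - weight n c (dig (a t)).
  apply/eqP; rewrite -dvdz_eq.
  have -> : t - weight n c (dig (a t)) = (t + (a t)%:Z * b%:Z)
    - (weight n c (dig (a t)) + (a t)%:Z * b%:Z) by ring.
  by rewrite rpredB // wt_mod.
have lamE t : lam t =
    pi0 ^ ((t - weight n c (dig (a t))) %/ N)%Z *: rho p n X (a t).
  by rewrite /lam /lambda v_rho.
have v_lam t : vn (lam t) = t%:E.
  rewrite lamE (dval_scale ram (dval_exprz _ v_pi0) (v_rho _)) mul1r mulrC.
  by rewrite lam_exp subrK.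
split=> //.
- move=> t; rewrite !lamE; have -> : a (t + N%:Z) = a t.
    apply/esym/eqP; rewrite /a frak_aP // ?a_lt // -/N addrAC.
    by apply: rpredD; [apply: a_dvd | apply: dvdzz].
  have -> : t + N%:Z - weight n c (dig (a t)) =
      1 * N%:Z + (t - weight n c (dig (a t))) by ring.
  rewrite divzMDl; last by rewrite eqz_nat -lt0n.
  by rewrite expfzDr // scalerA.
- exact: (Theta_fix1 p_pr Theta_def).
move=> i j i_n l; have [i1 i_le] := andP i_n.
have v_l : vn l = (j + (p ^ (n - i))%N%:Z * bb i)%:E by apply: v_lam.
have l_neq0 := dval_neq0 v_l.
set f := ((j - weight n c (dig (a j))) %/ N)%Z.
have Ef : N%:Z * f = j - weight n c (dig (a j)) by rewrite mulrC lam_exp.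
pose M := if (0 < dig (a j) i)%N
  then binom_prod n X (upd (dig (a j)) i (dig (a j) i).-1) else 0.
(* Adding c_i to [j] subtracts p^(n-i) from [a j], because b_i is congruent to [b]. The index and
   the weight both grow by c_i, so the exponent [f] of [pi0] is unchanged. *)
have -> : (if (1 <= digit p (a j) (n - i))%N then l else 0) = pi0 ^ f *: M.
  rewrite /M /dig; case: ifP => [dig_gt0|_]; last by rewrite scaler0.
  set a' := (a j - p ^ (n - i))%N.
  have le_a : (p ^ (n - i) <= a j)%N by apply: leq_digit dig_gt0.
  have lt_a' : (a' < N)%N by apply: leq_ltn_trans (a_lt j); apply: leq_subr.
  have Ea' : a (j + (p ^ (n - i))%N%:Z * bb i) = a'.
    apply/esym/eqP; rewrite /a frak_aP // -/N.
    have -> : j + (p ^ (n - i))%N%:Z * bb i + a'%:Z * b%:Z =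
        (j + (a j)%:Z * b%:Z) + (p ^ (n - i))%N%:Z * (bb i - b%:Z).
      by rewrite /a' -subzn //; ring.
    apply: rpredD; [exact: a_dvd | apply: dvdz_mull].
    by rewrite -eqz_mod_dvd; apply/eqP/A2.
  have dig' k : (1 <= k <= n)%N ->
      dig a' k = upd (dig (a j)) i (dig (a j) i - 1)%N k.
    move=> k_n; rewrite /dig digit_subX // /upd subn1.
    by have -> : (n - k == n - i)%N = (k == i) by lia.
  have w' : weight n c (dig a') = weight n c (dig (a j)) + c i.
    rewrite -[c i]mulr1n -(weight_upd c i_n (d := dig (a j))) // /weight.
    by congr (- _); apply: eq_big_nat => k k_n; rewrite dig'.
  rewrite /l lamE Ea' w'; congr (_ ^ _ *: _).
    by congr (_ %/ _)%Z; rewrite /c; ring.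
  by apply: eq_binom_prod => k k_n; split=> //; rewrite -/(dig a' k) dig' // subn1.
(* The error of [near i], scaled by [pi0 ^ f], has valuation at least j + c_i + E_i + T. Dividing by
   [l], of valuation j + c_i, leaves at least [T]. *)
exists ((gr_act (Psi i) (lam j) - pi0 ^ f *: M) / l); last by rewrite mulrC divfK.
rewrite inE lamE linearZ -scalerBr /= -mulr_algl -/f.
have vf : vge vn (N%:Z * f) (pi0 ^ f)%:A.
  by apply: (vge_alg ram); apply: vge_eq; rewrite (dval_exprz _ v_pi0) mul1r.
have near_M := near_i i i_n (dig (a j)) (dig_lt _).
apply: vgeW (vgeM (vgeM vf near_M) (vge_eq (dvalV v_l))).
have := excess_ge0 p_pr bb_gt0 (leqW i_le); rewrite Ef /c; lia.
Qed.
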